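(* Let $(M,\varphi,\xi,\eta,g)$ be a $3$-dimensional trans-Sasakian manifold of type $(\alpha,\beta)$ equipped with a Newman--Penrose frame $(\partial,\overline{\partial},\xi)$. Then the scalar curvature $\tau=\frac12\operatorname{tr}(S)$ of $M$ is given by $$\tau=-2\xi(\rho_{\mathrm{np}})-2\rho_{\mathrm{np}}^2-|\rho_{\mathrm{np}}|^2-2|\beta_{\mathrm{np}}|^2-(\rho_{\mathrm{np}}-\overline{\rho_{\mathrm{np}}})\epsilon_{\mathrm{np}}-\partial(\overline{\beta_{\mathrm{np}}})-\overline{\partial}(\beta_{\mathrm{np}}).$$
   Context: An almost contact metric structure $(\varphi,\xi,\eta,g)$ on $M$: $\varphi$ a $(1,1)$-tensor, $\xi$ a vector field, $\eta$ a $1$-form, $g$ a Riemannian metric with $\varphi^2=-I+\eta\otimes\xi$, $\eta(\xi)=1$, $\varphi\xi=0$, $\eta\circ\varphi=0$, $g(\varphi X,\varphi Y)=g(X,Y)-\eta(X)\eta(Y)$. It is trans-Sasakian of type $(\alpha,\beta)$ ($\alpha,\beta$ smooth functions) if $(\nabla_X\varphi)Y=\alpha(g(X,Y)\xi-\eta(Y)X)+\beta(g(\varphi X,Y)\xi-\eta(Y)\varphi X)$, with $\nabla$ the Levi-Civita connection. Newman--Penrose frame: for an orthonormal frame $(e_1,e_2,\xi)$, put $\partial=\frac1{\sqrt2}(e_1-ie_2)$, $\overline{\partial}=\frac1{\sqrt2}(e_1+ie_2)$, chosen so that $\varphi\partial=i\partial$, $\varphi\overline{\partial}=-i\overline{\partial}$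 (i.e. $\varphi e_1=e_2$). All tensors and $\nabla$ are extended complex-(multi)linearly, so $g(\xi,\xi)=g(\partial,\overline{\partial})=1$ and $g(\xi,\partial)=g(\partial,\partial)=g(\overline{\partial},\overline{\partial})=0$. Spin coefficients: $\sigma_{\mathrm{np}}=-g(\partial,\nabla_\partial\xi)$, $\rho_{\mathrm{np}}=g(\partial,\nabla_{\overline{\partial}}\xi)$, $\kappa_{\mathrm{np}}=-g(\partial,\nabla_\xi\xi)$, $\beta_{\mathrm{np}}=g(\overline{\partial},\nabla_\partial\partial)$, $\epsilon_{\mathrm{np}}=g(\overline{\partial},\nabla_\xi\partial)$. In these terms the trans-Sasakian condition of type $(\alpha,\beta)$ reads $\kappa_{\mathrm{np}}=\sigma_{\mathrm{np}}=0$, $\rho_{\mathrm{np}}=\beta+i\alpha$. For a function $f$, $\partial(f),\overline{\partial}(f),\xi(f)$ denote derivatives along these vector fields. $S$ is the Ricci tensor, $S(Y,Z)=\operatorname{tr}(X\mapsto R(X,Y)Z)$ with $R(X,Y)=[\nabla_X,\nabla_Y]-\nabla_{[X,Y]}$. Note the factor $\frac12$ in the paper's definition of scalar curvature $\tau=\frac12\operatorname{tr}(S)$. *)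

(* Defs.v *)
From HB Require Import structures.
From mathcomp Require Import all_boot all_order all_algebra.
From mathcomp Require Import all_classical all_reals all_analysis.
From mathcomp.real_closed Require Import complex.

Set Implicit Arguments.
Unset Strict Implicit.
Unset Printing Implicit Defensive.

Import Order.TTheory GRing.Theory Num.Theory.
Import numFieldNormedType.Exports.

Local Open Scope classical_set_scope.
Local Open Scope ring_scope.
Local Open Scope complex_scope.

Section Euclidean.
Context {R : realType} {n : nat}.

(* Class C^k on an open set [U]; the values of [f] outside [U] are irrelevant. *)
Fixpoint Ck (k : nat) (U : set 'rV[R]_n) (f : 'rV[R]_n -> R) : Prop :=
  (forall x, U x -> {for x, continuous f}) /\
  if k is k'.+1 then
    forall i : 'I_n,
      (forall x, U x -> derivable f x (delta_mx 0 i)) /\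
      Ck k' U (fun x => 'D_(delta_mx 0 i) f x)
  else True.

Definition Cinfty (U : set 'rV[R]_n) (f : 'rV[R]_n -> R) : Prop :=
  forall k, Ck k U f.

End Euclidean.

Record chart (R : realType) (n : nat) (T : topologicalType) := Chart {
  chart_dom : set T;
  chart_map : T -> 'rV[R]_n;
  chart_inv : 'rV[R]_n -> T;
  chart_open_dom : open chart_dom;
  chart_open_img : open (chart_map @` chart_dom);
  chart_mapK : {in chart_dom, cancel chart_map chart_inv};
  chart_map_cts : forall x, chart_dom x -> {for x, continuous chart_map};
  chart_inv_cts : forall y, (chart_map @` chart_dom) y ->
    {for y, continuous chart_inv} }.

Definition smooth_transition (R : realType) (n : nat) (T : topologicalType)
    (c d : chart R n T) : Prop :=
  forall i : 'I_n,
    Cinfty (chart_map c @` (chart_dom c `&` chart_dom d))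
           (fun y => chart_map d (chart_inv c y) 0 i).

Record manifold (R : realType) (n : nat) := Manifold {
  mfd_carrier :> topologicalType;
  mfd_hausdorff : hausdorff_space mfd_carrier;
  mfd_second_countable : @second_countable mfd_carrier;
  mfd_atlas : set (chart R n mfd_carrier);
  mfd_cover : forall p, exists2 c, mfd_atlas c & chart_dom c p;
  mfd_compat : forall c d, mfd_atlas c -> mfd_atlas d -> smooth_transition c d }.

Section SmoothFunctions.
Context {R : realType} {n : nat} {M : manifold R n}.

Definition smooth_on (W : set M) (f : M -> R) : Prop :=
  forall c, mfd_atlas c ->
    Cinfty (chart_map c @` (W `&` chart_dom c)) (f \o chart_inv c).

Definition smooth_at (p : M) (f : M -> R) : Prop :=
  exists W, [/\ open W, W p & smooth_on W f].

(* Tangent vectors are derivations of germs of smooth functions.  A derivation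
   at [p] is a total operator on functions which depends only on the germ at
   [p]; it is set to 0 on functions that are not smooth near [p], so that two
   derivations are equal as soon as they agree on smooth germs. *)
Definition point_derivation (p : M) (v : (M -> R) -> R^o) : Prop :=
  [/\ forall f, ~ smooth_at p f -> v f = 0,
      forall f h, (\forall q \near p, f q = h q) -> v f = v h,
      forall (a : R) f h, smooth_at p f -> smooth_at p h ->
        v (fun q => a * f q + h q) = a * v f + v h
    & forall f h, smooth_at p f -> smooth_at p h ->
        v (fun q => f q * h q) = f p * v h + h p * v f].

Definition point_derivation_pred (p : M) : pred ((M -> R) -> R^o) :=
  fun v => `[< point_derivation p v >].

Lemma point_derivation_closed (p : M) :
  subsemimod_closed (point_derivation_pred p).
Proof.
split; first split.
- have z0 f : (0 : (M -> R) -> R^o) f = 0 by [].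
  by apply/asboolP; split => [f nf|f h fh|a f h sf sh|f h sf sh];
    rewrite !z0 ?mulr0 ?addr0.
- have D (u v : (M -> R) -> R^o) f : (u + v) f = u f + v f by [].
  move=> u v /asboolP[u0 ug ul uL] /asboolP[v0 vg vl vL].
  apply/asboolP; split => [f nf|f h fh|a f h sf sh|f h sf sh]; rewrite !D.
  + by rewrite u0 // v0 // addr0.
  + by rewrite (ug _ _ fh) (vg _ _ fh).
  + by rewrite ul // vl // mulrDr addrACA.
  + by rewrite uL // vL // !mulrDr addrACA.
- have Z a (v : (M -> R) -> R^o) f : (a *: v) f = a * v f by [].
  move=> a v /asboolP[v0 vg vl vL].
  apply/asboolP; split => [f nf|f h fh|b f h sf sh|f h sf sh]; rewrite !Z.
  + by rewrite v0 // mulr0.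
  + by rewrite (vg _ _ fh).
  + by rewrite vl // mulrDr mulrCA.
  + by rewrite vL // mulrDr !(mulrCA a).
Qed.

HB.instance Definition _ (p : M) :=
  GRing.isSubmodClosed.Build R ((M -> R) -> R^o) (point_derivation_pred p)
    (point_derivation_closed p).

End SmoothFunctions.

Record tangent (R : realType) (n : nat) (M : manifold R n) (p : M) := Tangent {
  tangent_fun :> (M -> R) -> R^o;
  tangentP : point_derivation_pred p tangent_fun }.

Section TangentModule.
Context {R : realType} {n : nat} {M : manifold R n}.

HB.instance Definition _ (p : M) := [isSub for @tangent_fun R n M p].
HB.instance Definition _ (p : M) := [Choice of tangent p by <:].
HB.instance Definition _ (p : M) := [SubChoice_isSubLmodule of tangent p by <:].

End TangentModule.

Section Fields.
Context {R : realType} {n : nat} {M : manifold R n}.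

(* Smoothness is imposed separately, on open subsets of [M]. *)
Definition vfield := forall p : M, tangent p.

Definition smooth_vfield_on (U : set M) (X : vfield) : Prop :=
  forall (W : set M) f, open W -> W `<=` U -> smooth_on W f ->
    smooth_on W (fun q => X q f).

Definition smooth_vfield_at (p : M) (X : vfield) : Prop :=
  exists U, [/\ open U, U p & smooth_vfield_on U X].

(* The default value 0 is only used if [X] or [Y] is not smooth near [p]. *)
Definition lie_bracket (X Y : vfield) : vfield := fun p =>
  insubd (0 : tangent p) (fun f : M -> R =>
    if `[< smooth_at p f >]
    then X p (fun q => Y q f) - Y p (fun q => X q f)
    else 0).

Definition riemannian_metric (g : forall p : M, tangent p -> tangent p -> R) :
    Prop :=
  [/\ forall p v, scalar (g p v),
      forall p v w, g p v w = g p w v,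
      forall p v, v != 0 -> 0 < g p v v
    & forall U X Y, open U -> smooth_vfield_on U X -> smooth_vfield_on U Y ->
        smooth_on U (fun p => g p (X p) (Y p))].

(* [nabla p v Y] is the covariant derivative at [p] of [Y] along [v]. *)
Definition connection := forall p : M, tangent p -> vfield -> tangent p.

Definition affine_connection (nabla : connection) : Prop :=
  [/\ forall p Y, smooth_vfield_at p Y -> linear (fun v => nabla p v Y),
      forall p v Y Z, (\forall q \near p, Y q = Z q) ->
        nabla p v Y = nabla p v Z,
      forall p (v : tangent p) Y Z, smooth_vfield_at p Y -> smooth_vfield_at p Z ->
        nabla p v (fun q => Y q + Z q) = nabla p v Y + nabla p v Z,
      forall p v f Y, smooth_at p f -> smooth_vfield_at p Y ->
        nabla p v (fun q => f q *: Y q) = v f *: Y p + f p *: nabla p v Y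
    & forall U X Y, open U -> smooth_vfield_on U X -> smooth_vfield_on U Y ->
        smooth_vfield_on U (fun p => nabla p (X p) Y)].

Definition torsion_free (nabla : connection) : Prop :=
  forall p X Y, smooth_vfield_at p X -> smooth_vfield_at p Y ->
    nabla p (X p) Y - nabla p (Y p) X = lie_bracket X Y p.

Definition metric_compatible (g : forall p : M, tangent p -> tangent p -> R)
    (nabla : connection) : Prop :=
  forall p (v : tangent p) Y Z, smooth_vfield_at p Y -> smooth_vfield_at p Z ->
    v (fun q => g q (Y q) (Z q)) =
    g p (nabla p v Y) (Z p) + g p (Y p) (nabla p v Z).

Definition levi_civita (g : forall p : M, tangent p -> tangent p -> R)
    (nabla : connection) : Prop :=
  [/\ affine_connection nabla, torsion_free nabla & metric_compatible g nabla].

End Fields.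

Arguments vfield {R n} M.
Arguments connection {R n} M.

Section Trace.
Context {R : realType} {V : lmodType R}.

Definition is_basis (m : nat) (b : 'I_m -> V) : Prop :=
  forall v, exists! c : 'rV[R]_m, v = \sum_i c 0 i *: b i.

(* The trace of an endomorphism, computed in any basis. *)
Definition trace (f : V -> V) : R :=
  xget 0 [set t | exists (m : nat) (b : 'I_m -> V) (A : 'M[R]_m),
    [/\ is_basis b, forall i, f (b i) = \sum_j A i j *: b j & t = \tr A]].

(* The trace of a bilinear form [S] with respect to the metric [g]: the trace
   of the endomorphism [Q] with [g (Q x) y = S x y]. *)
Definition metric_trace (g S : V -> V -> R) : R :=
  xget 0 [set t | exists Q : V -> V,
    [/\ linear Q, forall x y, g (Q x) y = S x y & t = trace Q]].

End Trace.

Section Curvature.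
Context {R : realType} {n : nat} {M : manifold R n}.

Definition curvature_field (nabla : connection M) (X Y Z : vfield M) :
    vfield M := fun p =>
  nabla p (X p) (fun q => nabla q (Y q) Z)
  - nabla p (Y p) (fun q => nabla q (X q) Z)
  - nabla p (lie_bracket X Y p) Z.

(* The value of the curvature tensor on tangent vectors, computed from any
   smooth local extensions of these vectors. *)
Definition curvature (nabla : connection M) (p : M) (x y z : tangent p) :
    tangent p :=
  xget 0 [set w | exists X Y Z : vfield M,
    [/\ smooth_vfield_at p X, smooth_vfield_at p Y & smooth_vfield_at p Z] /\
    [/\ X p = x, Y p = y, Z p = z & w = curvature_field nabla X Y Z p]].

Definition ricci (nabla : connection M) (p : M) (y z : tangent p) : R :=
  trace (fun x => curvature nabla x y z).

(* The factor 1/2 is part of the definition used here. *)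
Definition scalar_curvature (nabla : connection M)
    (g : forall p : M, tangent p -> tangent p -> R) (p : M) : R :=
  2^-1 * metric_trace (g p) (@ricci nabla p).

End Curvature.

Section AlmostContact.
Context {R : realType} {n : nat} {M : manifold R n}.
Variables (phi : forall p : M, tangent p -> tangent p) (xi : vfield M)
  (eta : forall p : M, tangent p -> R)
  (g : forall p : M, tangent p -> tangent p -> R).

Record almost_contact_metric : Prop := AlmostContactMetric {
  acm_metric : riemannian_metric g;
  acm_phi_linear : forall p, linear (@phi p);
  acm_phi_smooth : forall U X, open U -> smooth_vfield_on U X ->
    smooth_vfield_on U (fun p => phi (X p));
  acm_xi_smooth : smooth_vfield_on setT xi;
  acm_eta_linear : forall p, scalar (@eta p);
  acm_eta_smooth : forall U X, open U -> smooth_vfield_on U X ->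
    smooth_on U (fun p => eta (X p));
  acm_phi2 : forall p (v : tangent p), phi (phi v) = - v + eta v *: xi p;
  acm_eta_xi : forall p, eta (xi p) = 1;
  acm_phi_xi : forall p, phi (xi p) = 0;
  acm_eta_phi : forall p (v : tangent p), eta (phi v) = 0;
  acm_compat : forall p (v w : tangent p),
    g (phi v) (phi w) = g v w - eta v * eta w }.

Record trans_sasakian (nabla : connection M) (alpha beta : M -> R) : Prop :=
  TransSasakian {
  ts_alpha_smooth : smooth_on setT alpha;
  ts_beta_smooth : smooth_on setT beta;
  ts_eq : forall p (v : tangent p) (Y : vfield M), smooth_vfield_at p Y ->
    nabla p v (fun q => phi (Y q)) - phi (nabla p v Y) =
    alpha p *: (g v (Y p) *: xi p - eta (Y p) *: v)
    + beta p *: (g (phi v) (Y p) *: xi p - eta (Y p) *: phi v) }.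

End AlmostContact.

(* [(x, y) : complexified V] stands for [x + 'i y]. *)
Definition complexified (R : rcfType) (V : lmodType R) : Type := (V * V)%type.

Section Complexified.
Context {R : rcfType} {V : lmodType R}.

HB.instance Definition _ := GRing.Zmodule.on (complexified V).

Definition complexified_scale (a : R[i]) (v : complexified V) :
    complexified V :=
  (complex.Re a *: v.1 - complex.Im a *: v.2,
   complex.Re a *: v.2 + complex.Im a *: v.1).

Lemma complexified_scaleA a b (v : complexified V) :
  complexified_scale a (complexified_scale b v) = complexified_scale (a * b) v.
Proof.
case: a b v => [a a'] [b b'] [x y]; rewrite /complexified_scale /=.
congr pair; rewrite !(scalerDr, scalerN, scalerDl, scaleNr, scalerA, opprD).
  by rewrite -!addrA; congr (_ + _); rewrite addrA addrC.
by rewrite -!addrA; congr (_ + _); rewrite addrA addrC.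
Qed.

Lemma complexified_scale1 : left_id 1 complexified_scale.
Proof.
by case=> x y; rewrite /complexified_scale /= !scale1r !scale0r subr0 addr0.
Qed.

Lemma complexified_scaleDr : right_distributive complexified_scale +%R.
Proof.
move=> a [x y] [x' y']; rewrite /complexified_scale /=; congr pair.
  by rewrite !scalerDr opprD addrACA.
by rewrite !scalerDr addrACA.
Qed.

Lemma complexified_scaleDl (v : complexified V) :
  {morph complexified_scale^~ v : a b / a + b}.
Proof.
move: v => [x y] [a a'] [b b']; rewrite /complexified_scale /=; congr pair.
  by rewrite !scalerDl opprD addrACA.
by rewrite !scalerDl addrACA.
Qed.

HB.instance Definition _ := GRing.Zmodule_isLmodule.Build R[i] (complexified V)
  complexified_scaleA complexified_scale1 complexified_scaleDr
  complexified_scaleDl.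

Definition embedC (v : V) : complexified V := (v, 0).

Definition linC (f : V -> V) (v : complexified V) : complexified V :=
  (f v.1, f v.2).

Definition bilC (b : V -> V -> R) (v w : complexified V) : R[i] :=
  (b v.1 w.1 - b v.2 w.2) +i* (b v.1 w.2 + b v.2 w.1).

End Complexified.

Section ComplexFields.
Context {R : realType} {n : nat} {M : manifold R n}.

Definition cvfield := forall p : M, complexified (tangent p).

Definition direct_derivC (p : M) (v : complexified (tangent p)) (f : M -> R[i]) :
    R[i] :=
  let u q := complex.Re (f q) in
  let w q := complex.Im (f q) in
  ((v.1 u : R) - (v.2 w : R)) +i* ((v.1 w : R) + (v.2 u : R)).

Definition nablaC (nabla : connection M) (p : M)
    (v : complexified (tangent p)) (Y : cvfield) : complexified (tangent p) :=
  let Y1 q := (Y q).1 in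
  let Y2 q := (Y q).2 in
  (nabla p v.1 Y1 - nabla p v.2 Y2, nabla p v.1 Y2 + nabla p v.2 Y1).

End ComplexFields.

Arguments cvfield {R n} M.

Section NewmanPenrose.
Context {R : realType} {M : manifold R 3}.
Variables (phi : forall p : M, tangent p -> tangent p) (xi : vfield M)
  (g : forall p : M, tangent p -> tangent p -> R) (nabla : connection M).
Variables e1 e2 : vfield M.

Definition np_del : cvfield M := fun p =>
  ((Num.sqrt 2)^-1)%:C *: (embedC (e1 p) - 'i%C *: embedC (e2 p)).

Definition np_delbar : cvfield M := fun p =>
  ((Num.sqrt 2)^-1)%:C *: (embedC (e1 p) + 'i%C *: embedC (e2 p)).

Definition np_xi : cvfield M := fun p => embedC (xi p).

Definition frame3 (p : M) : 'I_3 -> tangent p :=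
  fun i => nth 0 [:: e1 p; e2 p; xi p] i.

(* The frame is only required over [U]: it may be local or global. *)
Record np_frame (U : set M) : Prop := NPFrame {
  npf_open : open U;
  npf_smooth1 : smooth_vfield_on U e1;
  npf_smooth2 : smooth_vfield_on U e2;
  npf_basis : forall p, U p -> is_basis (frame3 p);
  npf_orthonormal : forall p, U p -> forall i j : 'I_3,
    g (frame3 p i) (frame3 p j) = (i == j)%:R;
  npf_del : forall p, U p -> linC (@phi p) (np_del p) = 'i%C *: np_del p;
  npf_delbar : forall p, U p ->
    linC (@phi p) (np_delbar p) = - 'i%C *: np_delbar p }.

Definition rho_np (p : M) : R[i] :=
  bilC (@g p) (np_del p) (nablaC nabla (np_delbar p) np_xi).

Definition beta_np (p : M) : R[i] :=
  bilC (@g p) (np_delbar p) (nablaC nabla (np_del p) np_del).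

Definition epsilon_np (p : M) : R[i] :=
  bilC (@g p) (np_delbar p) (nablaC nabla (np_xi p) np_del).

End NewmanPenrose.

(* Main.v *)
(** In an orthonormal frame [E i] the coefficients
    [Gamma i j k = g (nabla_(E i) (E j)) (E k)] are antisymmetric in [j], [k],
    and the curvature is a polynomial in them and their derivatives along the
    frame; since the curvature field is tensorial, [tr S] is the sum of
    [g (R (E i) (E j) (E j)) (E i)] over [i], [j].  For [(e1, e2, xi)] the
    trans-Sasakian equation gives
    [nabla_v xi = beta (v - eta v xi) - alpha (phi v)], so only
    [a, b, c = Gamma _ e1 e2] along [e1, e2, xi] remain free, with
    [rho = beta + i alpha], [beta_np = (b + i a) / sqrt 2] and
    [epsilon = i c].  This matches the real parts.  The imaginary part of the
    right-hand side is [- 2 xi(alpha) - 4 alpha beta], which vanishes by the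
    [xi]-component of the Jacobi identity for [e1], [e2], [xi]. *)

From HB Require Import structures.
Require Import Defs.
From mathcomp Require Import all_boot all_order all_algebra.
From mathcomp Require Import all_classical all_reals all_analysis.
From mathcomp.real_closed Require Import complex.
From mathcomp Require Import ring lra.

Import Order.TTheory GRing.Theory Num.Theory.
Import numFieldNormedType.Exports.

Local Open Scope classical_set_scope.
Local Open Scope ring_scope.
Local Open Scope complex_scope.

Set Implicit Arguments.
Unset Strict Implicit.
Unset Printing Implicit Defensive.

(** * Smooth functions and tangent vectors *)

Section CkCalculus.
Context {R : realType} {n : nat}.
Implicit Types (U : set 'rV[R]_n) (f h : 'rV[R]_n -> R).

Lemma CkS k U f : Ck k.+1 U f ->
  [/\ forall x, U x -> {for x, continuous f},
      forall i x, U x -> derivable f x (delta_mx 0 i)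
    & forall i, Ck k U (fun x => 'D_(delta_mx 0 i) f x)].
Proof. by case=> c d; split=> // i; case: (d i). Qed.

Lemma Ck_pred k U f : Ck k.+1 U f -> Ck k U f.
Proof.
elim: k f => [|k IH] f; first by case.
by move=> /CkS[c d D]; split=> // i; split; [exact: d|exact/IH/D].
Qed.

Lemma sub_Ck k U V f : V `<=` U -> Ck k U f -> Ck k V f.
Proof.
move=> VU; elim: k f => [|k IH] f; first by case=> c _; split=> // x /VU/c.
by move=> /CkS[c d D]; split=> [x /VU/c//|i]; split=> [x /VU/d|]; last exact/IH/D.
Qed.

(** Openness turns equality on [U] into equality of germs at each point of [U], which continuity and
    partial derivatives respect. *)
Lemma eq_Ck k U f h : open U -> {in U, f =1 h} -> Ck k U f -> Ck k U h.
Proof.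
move=> oU; elim: k f h => [|k IH] f h fh.
  case=> c _; split=> // x Ux.
  have e : \forall y \near x, f y = h y.
    by near=> y; apply/fh/mem_set; near: y; exact: open_nbhs_nbhs.
  by apply: cvg_trans (near_eq_cvg e) _; rewrite -fh ?inE//; exact: c.
move=> /CkS[c d D].
have e x : U x -> \forall y \near x, f y = h y.
  by move=> Ux; near=> y; apply/fh/mem_set; near: y; exact: open_nbhs_nbhs.
(* Germ invariance of directional derivatives is available for nonzero directions. *)
have nz (i : 'I_n) : delta_mx 0 i != 0 :> 'rV[R]_n.
  by apply/negP => /eqP/rowP/(_ i); rewrite !mxE !eqxx => /eqP; rewrite oner_eq0.
split=> [x Ux|i].
  by apply: cvg_trans (near_eq_cvg (e _ Ux)) _; rewrite -fh ?inE//; exact: c.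
split=> [x Ux|].
  by apply: near_eq_derivable (e _ Ux) (d i x Ux).
apply: IH (D i) => x /set_mem Ux.
by apply: near_eq_derive (e _ Ux).
Unshelve. all: by end_near. Qed.

Lemma Ck_cst k U (a : R) : Ck k U (fun=> a).
Proof.
elim: k a => [|k IH] a; first by split=> // x _; exact: cst_continuous.
split=> [x _|i]; first exact: cst_continuous.
split=> [x _|]; first exact: derivable_cst.
suff -> : (fun x : 'rV[R]_n => 'D_(delta_mx 0 i) (fun=> a) x) = fun=> 0 :> R.
  exact: IH.
by apply/funext => x; rewrite derive_cst.
Qed.

Lemma CkD k U f h : open U -> Ck k U f -> Ck k U h -> Ck k U (fun x => f x + h x).
Proof.
move=> oU; elim: k f h => [|k IH] f h.
  by move=> [cf _] [ch _]; split=> // x Ux; apply: continuousD; [exact: cf|exact: ch].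
move=> /CkS[cf df Df] /CkS[ch dh Dh]; split=> [x Ux|i].
  by apply: continuousD; [exact: cf|exact: ch].
split=> [x Ux|]; first by apply: derivableD; [exact: df|exact: dh].
apply: eq_Ck (IH _ _ (Df i) (Dh i)) => // x /set_mem Ux.
by rewrite -deriveD//; [exact: df|exact: dh].
Qed.

Lemma CkM k U f h : open U -> Ck k U f -> Ck k U h -> Ck k U (fun x => f x * h x).
Proof.
move=> oU; elim: k f h => [|k IH] f h.
  by move=> [cf _] [ch _]; split=> // x Ux; apply: continuousM; [exact: cf|exact: ch].
move=> Cf Ch; have Cf' := Ck_pred Cf; have Ch' := Ck_pred Ch.
move: Cf Ch => /CkS[cf df Df] /CkS[ch dh Dh]; split=> [x Ux|i].
  by apply: continuousM; [exact: cf|exact: ch].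
split=> [x Ux|]; first by apply: derivableM; [exact: df|exact: dh].
(* By the Leibniz rule the partial derivative pairs each factor with a partial of the other, so the
   factors themselves are used at order [k]. *)
have := CkD oU (IH _ _ Cf' (Dh i)) (IH _ _ Ch' (Df i)).
apply: eq_Ck => // x /set_mem Ux.
by rewrite -deriveM//; [exact: df|exact: dh].
Qed.

End CkCalculus.

(** * Smooth functions on a manifold *)

Section SmoothFunctionTheory.
Context {R : realType} {n : nat} {M : manifold R n}.
Implicit Types (W : set M) (f h : M -> R) (p : M).

(** Near an image point one stays in the open chart image, and the continuous inverse chart lands in
    [W]. This carries the [Ck] lemmas for open sets over to [M]. *)
Lemma open_chart_img (c : chart R n M) W : open W ->
  open (chart_map c @` (W `&` chart_dom c)).
Proof.
move=> oW; rewrite openE => _ [q [Wq dq] <-]; rewrite /interior.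
have i1 : nbhs (chart_map c q) (chart_map c @` chart_dom c).
  by apply: open_nbhs_nbhs; split; [exact: chart_open_img|exists q].
have i2 : nbhs (chart_map c q) (chart_inv c @^-1` W).
  apply: (chart_inv_cts (c := c)); first by exists q.
  by rewrite (chart_mapK (c := c)) ?inE//; exact: open_nbhs_nbhs.
near=> y.
have [r dr yr] : (chart_map c @` chart_dom c) y by near: y.
exists r => //; split=> //.
have : W (chart_inv c y) by near: y.
by rewrite -yr (chart_mapK (c := c)) ?inE.
Unshelve. all: by end_near. Qed.

Lemma sub_smooth_on W W' f : W' `<=` W -> smooth_on W f -> smooth_on W' f.
Proof.
move=> s sf c ac k; apply: sub_Ck (sf c ac k).
by move=> _ [q [Wq dq] <-]; exists q => //; split=> //; exact: s.
Qed.

Lemma eq_smooth_on W f h : open W -> {in W, f =1 h} ->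
  smooth_on W f -> smooth_on W h.
Proof.
move=> oW fh sf c ac k; apply: eq_Ck (sf c ac k); first exact: open_chart_img.
by move=> _ /set_mem[q [Wq dq] <-] /=; rewrite (chart_mapK (c := c)) ?inE// fh ?inE.
Qed.

Lemma smooth_on_cst W (a : R) : smooth_on W (fun=> a).
Proof. by move=> c ac k; exact: Ck_cst. Qed.

Lemma smooth_onD W f h : open W -> smooth_on W f -> smooth_on W h ->
  smooth_on W (fun q => f q + h q).
Proof.
move=> oW sf sh c ac k.
exact: (CkD (open_chart_img oW) (sf c ac k) (sh c ac k)).
Qed.

Lemma smooth_onM W f h : open W -> smooth_on W f -> smooth_on W h ->
  smooth_on W (fun q => f q * h q).
Proof.
move=> oW sf sh c ac k.
exact: (CkM (open_chart_img oW) (sf c ac k) (sh c ac k)).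
Qed.

Lemma smooth_at_cst p (a : R) : smooth_at p (fun=> a).
Proof. by exists setT; split; [exact: openT| |exact: smooth_on_cst]. Qed.

Lemma smooth_at2 p f h : smooth_at p f -> smooth_at p h ->
  exists W, [/\ open W, W p, smooth_on W f & smooth_on W h].
Proof.
move=> [W [oW Wp sf]] [V [oV Vp sh]]; exists (W `&` V); split=> //.
- exact: openI.
- exact: sub_smooth_on sf.
- by apply: sub_smooth_on sh => ? [].
Qed.

Lemma smooth_atD p f h : smooth_at p f -> smooth_at p h ->
  smooth_at p (fun q => f q + h q).
Proof.
move=> sf sh; have [W [oW Wp Wf Wh]] := smooth_at2 sf sh.
by exists W; split=> //; exact: smooth_onD.
Qed.

Lemma smooth_atM p f h : smooth_at p f -> smooth_at p h ->
  smooth_at p (fun q => f q * h q).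
Proof.
move=> sf sh; have [W [oW Wp Wf Wh]] := smooth_at2 sf sh.
by exists W; split=> //; exact: smooth_onM.
Qed.

Lemma smooth_atN p f : smooth_at p f -> smooth_at p (fun q => - f q).
Proof.
move=> sf; have := smooth_atM (smooth_at_cst p (- 1)) sf.
by under eq_fun do rewrite mulN1r.
Qed.

Lemma smooth_atB p f h : smooth_at p f -> smooth_at p h ->
  smooth_at p (fun q => f q - h q).
Proof. by move=> sf /smooth_atN; exact: smooth_atD. Qed.

Lemma near_smooth_at p f : smooth_at p f -> \forall q \near p, smooth_at q f.
Proof.
move=> [W [oW Wp sf]]; near=> q; exists W; split=> //.
by near: q; exact: open_nbhs_nbhs.
Unshelve. all: by end_near. Qed.

Lemma eq_smooth_at p f h : (\forall q \near p, f q = h q) ->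
  smooth_at p f -> smooth_at p h.
Proof.
rewrite -[X in X -> _]/(nbhs p [set q | f q = h q]) nbhsE.
move=> [V [oV Vp] fh] [W [oW Wp sf]].
have oVW := openI oV oW.
exists (V `&` W); split=> //.
apply: (@eq_smooth_on _ f) => //; last by apply: sub_smooth_on sf => ? [].
by move=> q /set_mem[/fh].
Qed.

End SmoothFunctionTheory.

(** * Tangent vectors as derivations of germs *)

Section TangentTheory.
Context {R : realType} {n : nat} {M : manifold R n}.
Implicit Types (f h : M -> R) (p : M).

Lemma tangent0E p f : (0 : tangent p) f = 0. Proof. by []. Qed.

Lemma tangentDE p (u v : tangent p) f : (u + v) f = (u f + v f : R).
Proof. by []. Qed.

Lemma tangentNE p (u : tangent p) f : (- u) f = (- u f : R).
Proof. by []. Qed.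

Lemma tangentZE p a (u : tangent p) f : (a *: u) f = (a * u f : R).
Proof. by []. Qed.

(** On functions that are not smooth near [p] both derivations take the default value 0. *)
Lemma tangent_inj p (u v : tangent p) :
  (forall f, smooth_at p f -> u f = v f) -> u = v.
Proof.
move=> uv; apply/val_inj/funext => f /=.
have [sf|nsf] := pselect (smooth_at p f); first exact: uv.
have /asboolP[u0 _ _ _] := tangentP u; have /asboolP[v0 _ _ _] := tangentP v.
by rewrite u0// v0.
Qed.

Lemma near_eq_tangent p (v : tangent p) f h :
  (\forall q \near p, f q = h q) -> v f = v h.
Proof. by have /asboolP[_ + _ _] := tangentP v; apply. Qed.

Lemma tangentM p (v : tangent p) f h : smooth_at p f -> smooth_at p h ->
  v (fun q => f q * h q) = (f p * v h + h p * v f : R).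
Proof. by have /asboolP[_ _ _ +] := tangentP v; apply. Qed.

Lemma tangentZD p (v : tangent p) a f h : smooth_at p f -> smooth_at p h ->
  v (fun q => a * f q + h q) = (a * v f + v h : R).
Proof. by have /asboolP[_ _ + _] := tangentP v; apply. Qed.

Lemma tangentD p (v : tangent p) f h : smooth_at p f -> smooth_at p h ->
  v (fun q => f q + h q) = (v f + v h : R).
Proof.
move=> sf sh; rewrite -[v f in RHS]mul1r -tangentZD//.
by under eq_fun do rewrite -[f _]mul1r.
Qed.

(** The Leibniz rule on [1 * 1] and on [0 * 0] kills the constants 1 and 0; linearity applied to
    [a * 1 + 0] gives the rest. *)
Lemma tangent_cst p (v : tangent p) (a : R) : v (fun=> a) = 0.
Proof.
have v1 : v (fun=> 1) = 0 :> R.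
  have s1 := smooth_at_cst p (1 : R).
  have := tangentM v s1 s1; under eq_fun do rewrite mulr1.
  by rewrite !mul1r => /eqP; rewrite -subr_eq0 opprD addrA subrr sub0r oppr_eq0 => /eqP.
have s1 := smooth_at_cst p (1 : R); have sa := smooth_at_cst p a.
have v0 : v (fun=> 0) = 0 :> R.
  have s0 := smooth_at_cst p (0 : R).
  have := tangentM v s0 s0; under eq_fun do rewrite mulr0.
  by rewrite !mul0r addr0.
have := tangentZD v a s1 (smooth_at_cst p (0 : R)).
by under eq_fun do rewrite mulr1 addr0; rewrite v1 v0 mulr0 addr0.
Qed.

Lemma tangentZ p (v : tangent p) a f : smooth_at p f ->
  v (fun q => a * f q) = (a * v f : R).
Proof.
by move=> sf; rewrite tangentM//; [rewrite tangent_cst mulr0 addr0|exact: smooth_at_cst].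
Qed.

Lemma tangentN p (v : tangent p) f : smooth_at p f ->
  v (fun q => - f q) = (- v f : R).
Proof.
move=> sf; rewrite -[in RHS]mulN1r -tangentZ//.
by under eq_fun do rewrite -mulN1r.
Qed.

Lemma tangentB p (v : tangent p) f h : smooth_at p f -> smooth_at p h ->
  v (fun q => f q - h q) = (v f - v h : R).
Proof. by move=> sf sh; rewrite tangentD ?tangentN//; exact: smooth_atN. Qed.

End TangentTheory.

(** * Connections and curvature *)

Section VectorFields.
Context {R : realType} {n : nat} {M : manifold R n}.
Implicit Types (X Y Z : vfield M) (f h : M -> R) (p : M).

Lemma vfield_ext X Y : (forall q, X q = Y q) -> X = Y.
Proof. exact: functional_extensionality_dep. Qed.

Lemma smooth_vfield_at2 p X Y : smooth_vfield_at p X -> smooth_vfield_at p Y ->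
  exists U, [/\ open U, U p, smooth_vfield_on U X & smooth_vfield_on U Y].
Proof.
move=> [U [oU Up sX]] [V [oV Vp sY]]; exists (U `&` V); split=> //.
- exact: openI.
- by move=> W f oW WUV; apply: sX => // ? /WUV[].
- by move=> W f oW WUV; apply: sY => // ? /WUV[].
Qed.

Lemma near_smooth_vfield_at p X :
  smooth_vfield_at p X -> \forall q \near p, smooth_vfield_at q X.
Proof.
move=> [U [oU Up sX]]; near=> q; exists U; split=> //.
by near: q; exact: open_nbhs_nbhs.
Unshelve. all: by end_near. Qed.

Lemma smooth_at_derivation p X f : smooth_vfield_at p X -> smooth_at p f ->
  smooth_at p (fun q => X q f).
Proof.
move=> [U [oU Up sX]] [W [oW Wp sf]]; exists (U `&` W).
have oUW := openI oU oW; split=> //; apply: sX => //.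
by apply: sub_smooth_on sf => ? [].
Qed.

Lemma smooth_vfield_atD p X Y : smooth_vfield_at p X -> smooth_vfield_at p Y ->
  smooth_vfield_at p (fun q => X q + Y q).
Proof.
move=> sX sY; have [U [oU Up UX UY]] := smooth_vfield_at2 sX sY.
exists U; split=> // W f oW WU sf.
by apply: (smooth_onD oW); [exact: UX|exact: UY].
Qed.

Lemma smooth_vfield_atZ p f X : smooth_at p f -> smooth_vfield_at p X ->
  smooth_vfield_at p (fun q => f q *: X q).
Proof.
move=> [V [oV Vp sf]] [U [oU Up sX]]; exists (U `&` V); split=> //.
  exact: openI.
move=> W h oW WUV sh.
apply: (smooth_onM oW); first by apply: sub_smooth_on sf => ? /WUV[].
by apply: sX => // ? /WUV[].
Qed.

Lemma eq_smooth_vfield_at p X Y : (\forall q \near p, X q = Y q) ->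
  smooth_vfield_at p X -> smooth_vfield_at p Y.
Proof.
rewrite -[X in X -> _]/(nbhs p [set q | X q = Y q]) nbhsE.
move=> [V [oV Vp] XY] [U [oU Up sX]]; exists (V `&` U); split=> //.
  exact: openI.
move=> W f oW WVU sf; apply: (eq_smooth_on (f := fun q => X q f)) => //.
  by move=> q /set_mem/WVU[/XY/= ->].
by apply: sX => // ? /WVU[].
Qed.

Lemma smooth_vfield_at0 p : smooth_vfield_at p (fun q => 0 : tangent q).
Proof.
by exists setT; split=> //; [exact: openT|move=> W f _ _ _; exact: smooth_on_cst].
Qed.

Lemma smooth_vfield_at_sum p (I : Type) (s : seq I) (X : I -> vfield M) :
  (forall i, smooth_vfield_at p (X i)) ->
  smooth_vfield_at p (fun q => \sum_(i <- s) X i q).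
Proof.
move=> sX; elim: s => [|i s IH].
  apply: eq_smooth_vfield_at (smooth_vfield_at0 p).
  by apply: nearW => q; rewrite big_nil.
apply: eq_smooth_vfield_at (smooth_vfield_atD (sX i) IH).
by apply: nearW => q; rewrite big_cons.
Qed.

(** The bracket falls back on 0 unless the commutator is a point derivation, so the proof checks the
    four axioms for it. *)
Lemma lie_bracketE p X Y f : smooth_vfield_at p X -> smooth_vfield_at p Y ->
  smooth_at p f ->
  lie_bracket X Y p f = X p (fun q => Y q f) - Y p (fun q => X q f) :> R.
Proof.
move=> sX sY sf; rewrite /lie_bracket insubdK/=; first by rewrite asboolT.
apply/asboolP; split=> [{sf}f nsf|{sf}f h fh|a {sf}f h sf sh|{sf}f h sf sh].
- by rewrite asboolF.
(* The inner derivative is taken at points near [p], where [f] and [h] still have equal germs. *)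
- have XY Z : \forall q \near p, Z q f = Z q h.
    have : \forall q \near p, \forall r \near q, f r = h r by exact: near_join.
    by apply: filterS => q; exact: near_eq_tangent.
  have -> : `[< smooth_at p f >] = `[< smooth_at p h >].
    apply/asbool_equiv_eq; split; apply: eq_smooth_at => //.
    by apply: filterS fh => q ->.
  by rewrite (near_eq_tangent (X p) (XY Y)) (near_eq_tangent (Y p) (XY X)).
- rewrite !asboolT//; last first.
    by apply: smooth_atD => //; apply: smooth_atM => //; exact: smooth_at_cst.
  have E Z : \forall q \near p, Z q (fun r => a * f r + h r) = a * Z q f + Z q h.
    near=> q; apply: tangentZD; near: q; exact: near_smooth_at.
  rewrite (near_eq_tangent (X p) (E Y)) (near_eq_tangent (Y p) (E X)).
  rewrite !tangentZD; try exact: smooth_at_derivation.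
  by ring.
- rewrite !asboolT//; last exact: smooth_atM.
  (* Differentiating this expansion again gives products of first derivatives that are symmetric in
     [X] and [Y], hence cancel in the commutator. *)
  have E Z : \forall q \near p, Z q (fun r => f r * h r) = f q * Z q h + h q * Z q f.
    near=> q; apply: tangentM; near: q; exact: near_smooth_at.
  rewrite (near_eq_tangent (X p) (E Y)) (near_eq_tangent (Y p) (E X)).
  rewrite !tangentD ?tangentM//; try exact: smooth_at_derivation;
    try (by apply: smooth_atM => //; exact: smooth_at_derivation).
  by ring.
Unshelve. all: by end_near. Qed.

End VectorFields.

(** * Affine connections *)

Section Connections.
Context {R : realType} {n : nat} {M : manifold R n}.
Variable nabla : connection M.
Arguments nabla : clear implicits.
Hypothesis aff : affine_connection nabla.
Implicit Types (X Y Z : vfield M) (f : M -> R) (p : M).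

Lemma nablaDl p u v Y : smooth_vfield_at p Y ->
  nabla p (u + v) Y = nabla p u Y + nabla p v Y.
Proof. by case: aff => L _ _ _ _ /L/(_ 1 u v); rewrite !scale1r. Qed.

Lemma nabla0l p Y : smooth_vfield_at p Y -> nabla p 0 Y = 0.
Proof.
move=> sY; have /eqP := nablaDl 0 0 sY.
by rewrite addr0 -subr_eq0 opprD addrA subrr sub0r oppr_eq0 => /eqP.
Qed.

Lemma nablaZl p a v Y : smooth_vfield_at p Y ->
  nabla p (a *: v) Y = a *: nabla p v Y.
Proof.
move=> sY; case: aff => /(_ p Y sY a v 0) + _ _ _ _.
by rewrite !addr0 nabla0l// addr0.
Qed.

Lemma nablaNl p v Y : smooth_vfield_at p Y -> nabla p (- v) Y = - nabla p v Y.
Proof. by move=> sY; rewrite -scaleN1r nablaZl// scaleN1r. Qed.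

Lemma nabla_suml p (I : Type) (s : seq I) (u : I -> tangent p) Y :
  smooth_vfield_at p Y ->
  nabla p (\sum_(i <- s) u i) Y = \sum_(i <- s) nabla p (u i) Y.
Proof.
move=> sY; elim: s => [|i s IH]; first by rewrite !big_nil nabla0l.
by rewrite !big_cons nablaDl// IH.
Qed.

Lemma near_eq_nabla p v Y Z : (\forall q \near p, Y q = Z q) ->
  nabla p v Y = nabla p v Z.
Proof. by case: aff => _ + _ _ _; apply. Qed.

Lemma nablaD p v Y Z : smooth_vfield_at p Y -> smooth_vfield_at p Z ->
  nabla p v (fun q => Y q + Z q) = nabla p v Y + nabla p v Z.
Proof. by case: aff => _ _ + _ _; apply. Qed.

Lemma nablaZ p (v : tangent p) f Y : smooth_at p f -> smooth_vfield_at p Y ->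
  nabla p v (fun q => f q *: Y q) = (v f : R) *: Y p + f p *: nabla p v Y.
Proof. by case: aff => _ _ _ + _; apply. Qed.

Lemma nabla_cstZ p (v : tangent p) (a : R) Y : smooth_vfield_at p Y ->
  nabla p v (fun q => a *: Y q) = a *: nabla p v Y.
Proof.
move=> sY; rewrite (nablaZ v (f := fun=> a))//; last exact: smooth_at_cst.
by rewrite tangent_cst scale0r add0r.
Qed.

Lemma smooth_vfield_at_nabla p X Y : smooth_vfield_at p X ->
  smooth_vfield_at p Y -> smooth_vfield_at p (fun q => nabla q (X q) Y).
Proof.
move=> sX sY; have [U [oU Up UX UY]] := smooth_vfield_at2 sX sY.
by exists U; split=> //; case: aff => _ _ _ _; apply.
Qed.

Lemma nabla_sum p v (I : Type) (s : seq I) (f : I -> M -> R) (Y : I -> vfield M) :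
  (forall i, smooth_at p (f i)) -> (forall i, smooth_vfield_at p (Y i)) ->
  nabla p v (fun q => \sum_(i <- s) f i q *: Y i q) =
  \sum_(i <- s) ((v (f i) : R) *: Y i p + f i p *: nabla p v (Y i)).
Proof.
move=> sf sY; have sfY i := smooth_vfield_atZ (sf i) (sY i).
elim: s => [|i s IH].
  rewrite big_nil.
  (* The zero field is the constant 0 times itself, so its covariant derivative vanishes. *)
  rewrite -(scale0r (nabla p v (fun q => 0))) -nabla_cstZ//; last first.
    exact: smooth_vfield_at0.
  by congr (nabla p v); apply: vfield_ext => q; rewrite scaler0 big_nil.
rewrite big_cons -IH -nablaZ// -nablaD//; last exact: smooth_vfield_at_sum.
by congr (nabla p v); apply: vfield_ext => q; rewrite big_cons.
Qed.

(** * Tensoriality of the curvature in its three arguments *)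

Section Curvature.
Hypothesis tor : torsion_free nabla.

(** Zero torsion trades the bracket for covariant derivatives, so the rules for [nabla] alone handle
    the arguments [X] and [Y]. *)
Lemma curvature_fieldE p X Y Z : smooth_vfield_at p X -> smooth_vfield_at p Y ->
  curvature_field nabla X Y Z p =
  nabla p (X p) (fun q => nabla q (Y q) Z)
  - nabla p (Y p) (fun q => nabla q (X q) Z)
  - nabla p (nabla p (X p) Y - nabla p (Y p) X) Z.
Proof. by move=> sX sY; rewrite /curvature_field -tor. Qed.

(** Linearity over smooth functions, with locality listed apart because a frame expands a field only
    near [p]. Given a frame, both together make [F X] depend on [X p] alone. *)
Definition tensorial p (F : vfield M -> tangent p) : Prop :=
  [/\ forall X Y, smooth_vfield_at p X -> (\forall q \near p, X q = Y q) ->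
        F X = F Y,
      forall X Y, smooth_vfield_at p X -> smooth_vfield_at p Y ->
        F (fun q => X q + Y q) = F X + F Y
    & forall f X, smooth_at p f -> smooth_vfield_at p X ->
        F (fun q => f q *: X q) = f p *: F X].

Lemma tensorial_sum p F (I : Type) (s : seq I) (f : I -> M -> R)
    (Y : I -> vfield M) : tensorial (p := p) F ->
  (forall i, smooth_at p (f i)) -> (forall i, smooth_vfield_at p (Y i)) ->
  F (fun q => \sum_(i <- s) f i q *: Y i q) = \sum_(i <- s) f i p *: F (Y i).
Proof.
move=> [_ FD FZ] sf sY; have sfY i := smooth_vfield_atZ (sf i) (sY i).
elim: s => [|i s IH].
  rewrite big_nil.
  rewrite -(scale0r (F (fun q => 0))) -(FZ (fun=> 0))//; last 2 first.
    exact: smooth_at_cst.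
    exact: smooth_vfield_at0.
  by congr F; apply: vfield_ext => q; rewrite scaler0 big_nil.
rewrite big_cons -IH -FZ// -FD//; last exact: smooth_vfield_at_sum.
by congr F; apply: vfield_ext => q; rewrite big_cons.
Qed.

(** Transfers tensoriality from the first argument to the second. *)
Lemma curvature_field_antisym p X Y Z : smooth_vfield_at p X ->
  smooth_vfield_at p Y -> smooth_vfield_at p Z ->
  curvature_field nabla Y X Z p = - curvature_field nabla X Y Z p.
Proof.
move=> sX sY sZ; rewrite !curvature_fieldE//.
rewrite -[nabla p (Y p) X - _]opprB nablaNl//.
by apply: tangent_inj => h _; rewrite !(tangentDE, tangentNE); ring.
Qed.

(** A scaling factor [f] is differentiated twice along [Y]: in [nabla_Y (f nabla_X Z)] and in the
    part [nabla_Y (f X)] of the bracket. The two resulting terms cancel. *)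
Lemma tensorial_curvature_field1 p Y Z : smooth_vfield_at p Y ->
  smooth_vfield_at p Z -> tensorial (fun X => curvature_field nabla X Y Z p).
Proof.
move=> sY sZ; split=> [X X' sX XX'|X X' sX sX'|f X sf sX].
- have sX' := eq_smooth_vfield_at XX' sX.
  have XX'p : X p = X' p by exact: nbhs_singleton XX'.
  rewrite !curvature_fieldE// XX'p (near_eq_nabla (Y p) XX').
  congr (_ - _ - _); apply: near_eq_nabla.
  by apply: filterS XX' => q ->.
- have sXX' := smooth_vfield_atD sX sX'.
  have sYZ := smooth_vfield_at_nabla sY sZ.
  rewrite !curvature_fieldE// !nablaDl// nablaD//.
  have E : \forall q \near p,
      nabla q (X q + X' q) Z = nabla q (X q) Z + nabla q (X' q) Z.
    by near=> q; apply: nablaDl; near: q; exact: near_smooth_vfield_at.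
  rewrite (near_eq_nabla _ E) nablaD; try exact: smooth_vfield_at_nabla.
  rewrite !(nablaNl, nablaDl)//.
  by apply: tangent_inj => h _; rewrite !(tangentDE, tangentNE); ring.
- have sfX := smooth_vfield_atZ sf sX.
  have sYZ := smooth_vfield_at_nabla sY sZ.
  rewrite !curvature_fieldE// !nablaZl// nablaZ//.
  have E : \forall q \near p, nabla q (f q *: X q) Z = f q *: nabla q (X q) Z.
    by near=> q; apply: nablaZl; near: q; exact: near_smooth_vfield_at.
  rewrite (near_eq_nabla _ E) nablaZ//; last exact: smooth_vfield_at_nabla.
  rewrite !(nablaNl, nablaDl, nablaZl)//.
  by apply: tangent_inj => h _; rewrite !(tangentDE, tangentNE, tangentZE); ring.
Unshelve. all: by end_near. Qed.

Lemma eq_tensorial p F G : (forall X, smooth_vfield_at p X -> F X = G X) ->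
  tensorial (p := p) F -> tensorial (p := p) G.
Proof.
move=> FG [Fl FD FZ]; split=> [X X' sX XX'|X X' sX sX'|f X sf sX].
- by rewrite -!FG//; [exact: Fl|exact: eq_smooth_vfield_at XX' _].
- by rewrite -!FG ?FD//; exact: smooth_vfield_atD.
- by rewrite -!FG ?FZ//; exact: smooth_vfield_atZ.
Qed.

Lemma tensorialN p F : tensorial (p := p) F -> tensorial (p := p) (fun X => - F X).
Proof.
move=> [Fl FD FZ]; split=> [X X' sX XX'|X X' sX sX'|f X sf sX].
- by rewrite (Fl _ _ sX XX').
- by rewrite FD// opprD.
- by rewrite FZ// scalerN.
Qed.

Lemma tensorial_curvature_field2 p X Z : smooth_vfield_at p X ->
  smooth_vfield_at p Z -> tensorial (fun Y => curvature_field nabla X Y Z p).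
Proof.
move=> sX sZ; apply: eq_tensorial (tensorialN (tensorial_curvature_field1 sX sZ)).
by move=> Y sY; rewrite -curvature_field_antisym.
Qed.

(** The second derivatives [X (Y f) - Y (X f)] cancel against the derivative of [f] along the
    bracket, which is therefore kept as a commutator. The mixed first-order terms are symmetric in
    [X] and [Y]. *)
Lemma tensorial_curvature_field3 p X Y : smooth_vfield_at p X ->
  smooth_vfield_at p Y -> tensorial (fun Z => curvature_field nabla X Y Z p).
Proof.
move=> sX sY; split=> [Z Z' sZ ZZ'|Z Z' sZ sZ'|f Z sf sZ].
- have ZZ V : \forall q \near p, nabla q (V q) Z = nabla q (V q) Z'.
    have : \forall q \near p, \forall r \near q, Z r = Z' r by exact: near_join.
    by apply: filterS => q; exact: near_eq_nabla.
  rewrite /curvature_field (near_eq_nabla _ (ZZ X)) (near_eq_nabla _ (ZZ Y)).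
  by rewrite (near_eq_nabla _ ZZ').
- have E V : smooth_vfield_at p V -> \forall q \near p,
      nabla q (V q) (fun r => Z r + Z' r) = nabla q (V q) Z + nabla q (V q) Z'.
    by move=> sV; near=> q; apply: nablaD; near: q; exact: near_smooth_vfield_at.
  rewrite /curvature_field (near_eq_nabla _ (E X sX)) (near_eq_nabla _ (E Y sY)).
  rewrite !nablaD//; try exact: smooth_vfield_at_nabla.
  by apply: tangent_inj => h _; rewrite !(tangentDE, tangentNE); ring.
- have E V : smooth_vfield_at p V -> \forall q \near p,
      nabla q (V q) (fun r => f r *: Z r) =
      (V q f : R) *: Z q + f q *: nabla q (V q) Z.
    move=> sV; near=> q; apply: nablaZ; near: q;
      [exact: near_smooth_at|exact: near_smooth_vfield_at].
  have sd V : smooth_vfield_at p V -> smooth_at p (fun q => V q f).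
    by move=> sV; exact: smooth_at_derivation.
  have sn V : smooth_vfield_at p V -> smooth_vfield_at p (fun q => nabla q (V q) Z).
    by move=> sV; exact: smooth_vfield_at_nabla.
  have D V W : smooth_vfield_at p V -> smooth_vfield_at p W ->
      nabla p (V p) (fun q => nabla q (W q) (fun r => f r *: Z r)) =
      (V p (fun q => W q f) : R) *: Z p + (W p f : R) *: nabla p (V p) Z +
      ((V p f : R) *: nabla p (W p) Z +
       f p *: nabla p (V p) (fun q => nabla q (W q) Z)).
    move=> sV sW; rewrite (near_eq_nabla _ (E W sW)) nablaD; last 2 first.
      by apply: smooth_vfield_atZ => //; exact: sd.
      by apply: smooth_vfield_atZ => //; exact: sn.
    by rewrite !nablaZ//; [exact: sn|exact: sd].
  rewrite /curvature_field !D// nablaZ// lie_bracketE//.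
  by apply: tangent_inj => h _; rewrite !(tangentDE, tangentNE, tangentZE); ring.
Unshelve. all: by end_near. Qed.

End Curvature.
End Connections.

(** * Traces *)

Section Traces.
Context {R : realType} {V : lmodType R}.

Lemma basis_coords_inj m (b : 'I_m -> V) (c d : 'I_m -> R) : is_basis b ->
  \sum_i c i *: b i = \sum_i d i *: b i -> c =1 d.
Proof.
move=> bb cd i; have [c' [_ u]] := bb (\sum_i c i *: b i).
have cE : c' = \row_i c i by apply: u; under [RHS]eq_bigr do rewrite mxE.
have dE : c' = \row_i d i by apply: u; under [RHS]eq_bigr do rewrite mxE.
by have /rowP/(_ i) := etrans (esym cE) dE; rewrite !mxE.
Qed.

Lemma basis_coords m k (b : 'I_m -> V) (v : 'I_k -> V) : is_basis b ->
  exists A : 'M[R]_(k, m), forall i, v i = \sum_j A i j *: b j.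
Proof.
move=> bb; have /choice[c vc] i : exists c : 'rV[R]_m, v i = \sum_j c 0 j *: b j.
  by have [c [vc _]] := bb (v i); exists c.
by exists (\matrix_(i, j) c i 0 j) => i; under eq_bigr do rewrite mxE.
Qed.

Lemma sumr_mulmx m k l (A : 'M[R]_(m, k)) (B : 'M[R]_(k, l)) (b : 'I_l -> V) i :
  \sum_j A i j *: (\sum_h B j h *: b h) = \sum_h (A *m B) i h *: b h.
Proof.
under eq_bigr do rewrite scaler_sumr; rewrite exchange_big/=.
apply: eq_bigr => h _; rewrite mxE scaler_suml.
by apply: eq_bigr => j _; rewrite scalerA.
Qed.

(* The bases may have different index types: only [P *m Q = 1] and [Q *m P = 1]
   are needed for the trace, not equality of the cardinalities. *)
Lemma basis_change m k (b : 'I_m -> V) (b' : 'I_k -> V)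
    (P : 'M[R]_(k, m)) (Q : 'M[R]_(m, k)) : is_basis b' ->
  (forall i, b' i = \sum_j P i j *: b j) ->
  (forall i, b i = \sum_j Q i j *: b' j) -> P *m Q = 1%:M.
Proof.
move=> bb' bP bQ; apply/matrixP => i j.
apply: (basis_coords_inj (c := (P *m Q) i) (d := (1%:M : 'M[R]_k) i) bb').
rewrite -sumr_mulmx; under eq_bigr do rewrite -bQ.
rewrite -bP (bigD1 i)//= mxE eqxx scale1r big1 ?addr0// => l li.
by rewrite mxE eq_sym (negPf li) scale0r.
Qed.

(** The choice made by [xget] is harmless: any two matrices of [f] are related by mutually inverse
    base changes [P] and [Q]. *)
Lemma traceE m (b : 'I_m -> V) (A : 'M[R]_m) (f : V -> V) : linear f ->
  is_basis b -> (forall i, f (b i) = \sum_j A i j *: b j) -> trace f = \tr A.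
Proof.
move=> lf bb fA; rewrite /trace; case: xgetP => [t _ [k [b' [A' [bb' fA' ->]]]]|];
  last first.
  by move/(_ (\tr A)); case; exists m, b, A.
pose F := HB.pack f (GRing.isLinear.Build R V V *:%R f lf) : {linear V -> V}.
have [P bP] := basis_coords b' bb; have [Q bQ] := basis_coords b bb'.
(* Both sides hold the coordinates of [f (b' i)] in the basis [b]. *)
have AP : A' *m P = P *m A.
  apply/matrixP => i; apply: (basis_coords_inj bb).
  rewrite -!sumr_mulmx; under eq_bigr do rewrite -bP; rewrite -fA'.
  under [RHS]eq_bigr do rewrite -fA.
  rewrite [in LHS]bP -[f]/(F : _ -> _) linear_sum.
  by apply: eq_bigr => j _; rewrite linearZ.
(* [tr A' = tr (A' P Q) = tr (P A Q) = tr (A Q P) = tr A]. *)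
rewrite -[A']mulmx1 -(basis_change bb' bP bQ) mulmxA AP -mulmxA mxtrace_mulC.
by rewrite -mulmxA (basis_change bb bQ bP) mulmx1.
Qed.

(** * Traces in an orthonormal basis *)

Section Orthonormal.
Variables (g : V -> V -> R) (m : nat) (b : 'I_m -> V).
Hypotheses (gl : forall v, scalar (g v)) (gC : forall v w, g v w = g w v).
Hypotheses (bb : is_basis b) (bo : forall i j, g (b i) (b j) = (i == j)%:R).

Lemma scalar_sum (s : V -> R) (I : finType) (c : I -> R) (v : I -> V) :
  scalar s -> s (\sum_i c i *: v i) = \sum_i c i * s (v i).
Proof.
move=> ls; pose S := HB.pack s (GRing.isLinear.Build R V R *%R s ls) : {scalar V}.
rewrite -[s]/(S : _ -> _) linear_sum.
by apply: eq_bigr => i _; rewrite linearZ.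
Qed.

Lemma orthonormal_expand v : v = \sum_i g v (b i) *: b i.
Proof.
have [c [vc _]] := bb v; rewrite {1}vc; apply: eq_bigr => i _; congr (_ *: _).
rewrite gC vc scalar_sum// (bigD1 i)//= bo eqxx mulr1 big1 ?addr0// => j ji.
by rewrite bo eq_sym (negPf ji) mulr0.
Qed.

Lemma trace_orthonormal (f : V -> V) : linear f ->
  trace f = \sum_i g (f (b i)) (b i).
Proof.
move=> lf; rewrite (traceE (A := \matrix_(i, j) g (f (b i)) (b j)) lf bb) => [|i].
  by apply: eq_bigr => i _; rewrite mxE.
by rewrite {1}[f (b i)]orthonormal_expand; apply: eq_bigr => j _; rewrite mxE.
Qed.

Lemma metric_trace_orthonormal (S : V -> V -> R) :
  (forall v, scalar (S v)) -> (forall v, scalar (S^~ v)) ->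
  metric_trace g S = \sum_i S (b i) (b i).
Proof.
move=> Sr Sl; rewrite /metric_trace; case: xgetP => [t _ [Q [lQ gQ ->]]|].
  by rewrite trace_orthonormal//; apply: eq_bigr => i _; rewrite gQ.
(* The endomorphism dual to [S]; its existence rules out the default value of [xget]. *)
pose Q x := \sum_i S x (b i) *: b i.
move/(_ (trace Q)); case; exists Q; split=> //.
  move=> a u v; rewrite /Q scaler_sumr -big_split/=; apply: eq_bigr => i _.
  by rewrite Sl scalerDl scalerA.
move=> x y; rewrite gC scalar_sum// [in RHS](orthonormal_expand y) scalar_sum//.
by apply: eq_bigr => i _; rewrite mulrC.
Qed.

End Orthonormal.
End Traces.

(** * Orthonormal frames *)

Section Jacobi.
Context {R : realType} {n : nat} {M : manifold R n}.
Variable nabla : connection M.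
Hypotheses (aff : affine_connection nabla) (tor : torsion_free nabla).
Arguments nabla : clear implicits.
Implicit Types (X Y Z : vfield M) (p : M).

Lemma near_lie_bracketE p X Y : smooth_vfield_at p X -> smooth_vfield_at p Y ->
  \forall q \near p, nabla q (X q) Y - nabla q (Y q) X = lie_bracket X Y q.
Proof.
by move=> sX sY; near=> q; apply: tor; near: q; exact: near_smooth_vfield_at.
Unshelve. all: by end_near. Qed.

(** Zero torsion makes the bracket a difference of covariant derivatives, whose smoothness is part
    of [affine_connection]. *)
Lemma smooth_vfield_at_lie_bracket p X Y : smooth_vfield_at p X ->
  smooth_vfield_at p Y -> smooth_vfield_at p (lie_bracket X Y).
Proof.
move=> sX sY; apply: eq_smooth_vfield_at (near_lie_bracketE sX sY) _.
have sYX := smooth_vfield_atZ (smooth_at_cst p (- 1)) (smooth_vfield_at_nabla aff sY sX).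
have := smooth_vfield_atD (smooth_vfield_at_nabla aff sX sY) sYX.
by apply: eq_smooth_vfield_at; apply: nearW => q; rewrite scaleN1r.
Qed.

(** Applied to a function, each double bracket is a sum of four triple derivatives; the twelve terms
    cancel in pairs. *)
Lemma lie_bracket_jacobi p X Y Z : smooth_vfield_at p X ->
  smooth_vfield_at p Y -> smooth_vfield_at p Z ->
  lie_bracket (lie_bracket X Y) Z p + lie_bracket (lie_bracket Y Z) X p +
  lie_bracket (lie_bracket Z X) Y p = 0.
Proof.
move=> sX sY sZ; apply: tangent_inj => f sf.
have B A B C : smooth_vfield_at p A -> smooth_vfield_at p B ->
    smooth_vfield_at p C ->
    lie_bracket (lie_bracket A B) C p f =
    A p (fun q => B q (fun r => C r f)) - B p (fun q => A q (fun r => C r f))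
    - (C p (fun q => A q (fun r => B r f)) - C p (fun q => B q (fun r => A r f))) :> R.
  move=> sA sB sC; have sCf := smooth_at_derivation sC sf.
  rewrite lie_bracketE//; last exact: smooth_vfield_at_lie_bracket.
  rewrite lie_bracketE//; congr (_ - _).
  rewrite -tangentB; last 2 first.
    by apply/smooth_at_derivation => //; exact: smooth_at_derivation.
    by apply/smooth_at_derivation => //; exact: smooth_at_derivation.
  apply: near_eq_tangent; near=> q; apply: lie_bracketE; near: q;
    [exact: near_smooth_vfield_at|exact: near_smooth_vfield_at|exact: near_smooth_at].
by rewrite !tangentDE !B// tangent0E; ring.
Unshelve. all: by end_near. Qed.

End Jacobi.

(** * Curvature, Ricci tensor and scalar curvature in a local orthonormal frame *)

Section OrthonormalFrames.
Context {R : realType} {n : nat} {M : manifold R n}.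
Variables (g : forall p : M, tangent p -> tangent p -> R) (nabla : connection M).
Hypotheses (rg : riemannian_metric g) (lc : levi_civita g nabla).
Variables (m : nat) (E : 'I_m -> vfield M) (U : set M).
Hypotheses (oU : open U) (Es : forall i, smooth_vfield_on U (E i)).
Hypotheses (Eb : forall p, U p -> is_basis (fun i => E i p)).
Hypotheses (Eo : forall p, U p -> forall i j, g (E i p) (E j p) = (i == j)%:R).
Arguments nabla : clear implicits.
Implicit Types (X Y Z : vfield M) (p : M).

Let aff : affine_connection nabla. Proof. by case: lc. Qed.
Let tor : torsion_free nabla. Proof. by case: lc. Qed.

Lemma metric_scalar p (v : tangent p) : scalar (g v).
Proof. by case: rg => + _ _ _; apply. Qed.

Lemma metricC p (v w : tangent p) : g v w = g w v.
Proof. by case: rg => _ + _ _; apply. Qed.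

Lemma metricDl p (u v w : tangent p) : g (u + v) w = g u w + g v w.
Proof.
by have := metric_scalar w 1 u v; rewrite mul1r scale1r !(metricC w).
Qed.

Lemma metric0l p (w : tangent p) : g 0 w = 0.
Proof.
have /eqP := metricDl 0 0 w.
by rewrite addr0 -subr_eq0 opprD addrA subrr sub0r oppr_eq0 => /eqP.
Qed.

Lemma metricZl p a (v w : tangent p) : g (a *: v) w = a * g v w.
Proof.
by have := metric_scalar w a v 0; rewrite !addr0 !(metricC w) metric0l addr0.
Qed.

Lemma metricNl p (v w : tangent p) : g (- v) w = - g v w.
Proof. by rewrite -scaleN1r metricZl mulN1r. Qed.

Lemma metricZr p a (v w : tangent p) : g w (a *: v) = a * g w v.
Proof. by rewrite !(metricC w) metricZl. Qed.

Lemma metricDr p (u v w : tangent p) : g w (u + v) = g w u + g w v.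
Proof. by rewrite !(metricC w) metricDl. Qed.

Lemma metricNr p (v w : tangent p) : g w (- v) = - g w v.
Proof. by rewrite !(metricC w) metricNl. Qed.

Lemma metric_suml p (I : finType) (u : I -> tangent p) w :
  g (\sum_i u i) w = \sum_i g (u i) w.
Proof.
apply: (big_morph (fun v : tangent p => g v w)) => [u' v'|].
  exact: metricDl.
exact: metric0l.
Qed.

Lemma smooth_at_metric p X Y : smooth_vfield_at p X -> smooth_vfield_at p Y ->
  smooth_at p (fun q => g (X q) (Y q)).
Proof.
move=> sX sY; have [W [oW Wp WX WY]] := smooth_vfield_at2 sX sY.
by exists W; split=> //; case: rg => _ _ _; apply.
Qed.

Lemma smooth_frame p i : U p -> smooth_vfield_at p (E i).
Proof. by exists U. Qed.

Lemma near_frame p : U p -> \forall q \near p, U q.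
Proof. by move=> Up; exact: open_nbhs_nbhs. Qed.

Lemma frame_expand p (v : tangent p) : U p -> v = \sum_i g v (E i p) *: E i p.
Proof.
move=> Up.
by apply: (orthonormal_expand (@metric_scalar p) (@metricC p) (Eb Up) (Eo Up)).
Qed.

(** Near [p] the field equals its frame expansion, whose coefficients are smooth; locality and
    linearity do the rest. *)
Lemma tensorial_frame p F X : tensorial (p := p) F -> U p ->
  smooth_vfield_at p X -> F X = \sum_i g (X p) (E i p) *: F (E i).
Proof.
move=> TF Up sX; have [Fl _ _] := TF.
have sE i := smooth_frame i Up.
rewrite (Fl X (fun q => \sum_i g (X q) (E i q) *: E i q))//; last first.
  by near=> q; apply: frame_expand; near: q; exact: near_frame.
by rewrite (tensorial_sum _ (f := fun i q => g (X q) (E i q)) (Y := E))// => i;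
  exact: smooth_at_metric.
Unshelve. all: by end_near. Qed.

(** The trilinear extension from the frame fields: a value of the curvature that involves no
    extension of the three vectors. *)
Definition frame_curvature p (x y z : tangent p) : tangent p :=
  \sum_i g x (E i p) *: \sum_j g y (E j p) *: \sum_k g z (E k p) *:
    curvature_field nabla (E i) (E j) (E k) p.

Lemma curvature_field_frame p X Y Z : U p -> smooth_vfield_at p X ->
  smooth_vfield_at p Y -> smooth_vfield_at p Z ->
  curvature_field nabla X Y Z p = frame_curvature (X p) (Y p) (Z p).
Proof.
move=> Up sX sY sZ; have sE i := smooth_frame i Up.
rewrite (tensorial_frame (tensorial_curvature_field1 aff tor sY sZ))//.
apply: eq_bigr => i _; congr (_ *: _).
rewrite (tensorial_frame (tensorial_curvature_field2 aff tor (sE i) sZ))//.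
apply: eq_bigr => j _; congr (_ *: _).
by rewrite (tensorial_frame (tensorial_curvature_field3 aff (sE i) (sE j))).
Qed.

(** Freezing the frame coefficients at [p] gives the field. It shows that [curvature] chooses from a
    nonempty set. *)
Lemma extend_tangent p (v : tangent p) : U p ->
  exists2 X, smooth_vfield_at p X & X p = v.
Proof.
move=> Up; exists (fun q => \sum_i g v (E i p) *: E i q).
  apply: smooth_vfield_at_sum => i.
  apply: (smooth_vfield_atZ (f := fun=> _)); first exact: smooth_at_cst.
  exact: smooth_frame.
by rewrite -frame_expand.
Qed.

(** All extensions give the same value by [curvature_field_frame], so the choice is forced. *)
Lemma curvatureE p (x y z : tangent p) : U p ->
  curvature nabla x y z = frame_curvature x y z.
Proof.
move=> Up; rewrite /curvature; case: xgetP => [w _ [X [Y [Z]]]|].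
  by move=> [[sX sY sZ] [<- <- <- ->]]; exact: curvature_field_frame.
have [X sX Xp] := extend_tangent x Up; have [Y sY Yp] := extend_tangent y Up.
have [Z sZ Zp] := extend_tangent z Up.
move/(_ (curvature_field nabla X Y Z p)); case; exists X, Y, Z; split=> //.
Qed.

Lemma metric_frame p i j : U p -> g (E i p) (E j p) = (i == j)%:R.
Proof. by move=> Up; exact: Eo. Qed.

Lemma sum_frame (W : lmodType R) p i (F : 'I_m -> W) : U p ->
  \sum_j g (E i p) (E j p) *: F j = F i.
Proof.
move=> Up; rewrite (bigD1 i)//= metric_frame// eqxx scale1r big1 ?addr0// => j ji.
by rewrite metric_frame// eq_sym (negPf ji) scale0r.
Qed.

Lemma ricciE p (y z : tangent p) : U p ->
  ricci nabla y z = \sum_i \sum_j \sum_k g y (E j p) * (g z (E k p) *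
    g (curvature_field nabla (E i) (E j) (E k) p) (E i p)).
Proof.
move=> Up; rewrite /ricci.
rewrite (_ : (fun x => _) = fun x => frame_curvature x y z); last first.
  by apply/funext => x; rewrite curvatureE.
rewrite (trace_orthonormal (@metric_scalar p) (@metricC p) (Eb Up) (Eo Up)).
  apply: eq_bigr => i _; rewrite /frame_curvature sum_frame// metric_suml.
  apply: eq_bigr => j _; rewrite metricZl metric_suml mulr_sumr.
  by apply: eq_bigr => k _; rewrite metricZl.
move=> a u v; rewrite /frame_curvature scaler_sumr -big_split/=.
by apply: eq_bigr => i _; rewrite metricDl metricZl scalerDl scalerA.
Qed.

Lemma scalar_curvature_frame p : U p -> scalar_curvature nabla g p =
  2^-1 * \sum_j \sum_i g (curvature_field nabla (E i) (E j) (E j) p) (E i p).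
Proof.
move=> Up; rewrite /scalar_curvature; congr (_ * _).
rewrite (metric_trace_orthonormal (@metric_scalar p) (@metricC p) (Eb Up) (Eo Up)).
- apply: eq_bigr => l _; rewrite ricciE//; apply: eq_bigr => i _.
  (* Viewing [R] as the module [R^o], [sum_frame] collapses the sums over [j] and [k] to the index
     [l]. *)
  have := sum_frame l (fun j => \sum_k g (E l p) (E k p) *:
    (g (curvature_field nabla (E i) (E j) (E k) p) (E i p) : R^o)) Up.
  rewrite (sum_frame l (fun k => g (curvature_field nabla (E i) (E l) (E k) p)
    (E i p) : R^o))// => <-.
  apply: eq_bigr => j _; rewrite scaler_sumr.
  by apply: eq_bigr => k _.
- move=> y a u v; rewrite !ricciE// mulr_sumr -big_split/=; apply: eq_bigr => i _.
  rewrite mulr_sumr -big_split/=; apply: eq_bigr => j _.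
  rewrite mulr_sumr -big_split/=; apply: eq_bigr => k _.
  by rewrite metricDl metricZl; ring.
- move=> y a u v; rewrite !ricciE// mulr_sumr -big_split/=; apply: eq_bigr => i _.
  rewrite mulr_sumr -big_split/=; apply: eq_bigr => j _.
  rewrite mulr_sumr -big_split/=; apply: eq_bigr => k _.
  by rewrite metricDl metricZl; ring.
Qed.

(** * Connection coefficients of the frame, with curvature and the Jacobi identity in terms of
    them *)

Definition christoffel i j k p : R := g (nabla p (E i p) (E j)) (E k p).
Local Notation Gamma := christoffel.

Lemma smooth_at_christoffel i j k p : U p -> smooth_at p (Gamma i j k).
Proof.
move=> Up; have sE l := smooth_frame l Up.
by apply: smooth_at_metric => //; exact: smooth_vfield_at_nabla.
Qed.

Lemma nabla_frame i j p : U p ->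
  nabla p (E i p) (E j) = \sum_k Gamma i j k p *: E k p.
Proof. by move=> Up; rewrite {1}[LHS](frame_expand _ Up). Qed.

(** By metric compatibility the sum of the two is the derivative of [g (E j) (E k)], which is
    constant near [p]. *)
Lemma christoffel_antisym i j k p : U p -> Gamma i j k p = - Gamma i k j p.
Proof.
move=> Up; have sE l := smooth_frame l Up.
have [_ _ /(_ p (E i p) (E j) (E k) (sE j) (sE k))] := lc.
rewrite (near_eq_tangent _ (h := fun=> (j == k)%:R)).
  rewrite tangent_cst -[g (E j p) _]metricC => /esym/eqP.
  by rewrite addr_eq0 => /eqP.
near=> q; apply: metric_frame; near: q; exact: near_frame.
Unshelve. all: by end_near. Qed.

(** The frame expansion of the inner derivative holds near [p] and can be differentiated: its
    coefficients give the first term, the frame fields give the sum. *)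
Lemma metric_nabla2_frame i j k l p : U p ->
  g (nabla p (E i p) (fun q => nabla q (E j q) (E k))) (E l p) =
  E i p (Gamma j k l) + \sum_h Gamma j k h p * Gamma i h l p.
Proof.
move=> Up; have sE h := smooth_frame h Up.
have near_nabla : \forall q \near p,
    nabla q (E j q) (E k) = \sum_h Gamma j k h q *: E h q.
  by near=> q; apply: nabla_frame; near: q; exact: near_frame.
rewrite (near_eq_nabla aff _ near_nabla) nabla_sum//; last first.
  by move=> h; exact: smooth_at_christoffel.
rewrite big_split/= metricDl !metric_suml; congr (_ + _).
  rewrite (bigD1 l)//= metricZl metric_frame// eqxx mulr1 big1 ?addr0// => h hl.
  by rewrite metricZl metric_frame// (negPf hl) mulr0.
by apply: eq_bigr => h _; rewrite metricZl.
Unshelve. all: by end_near. Qed.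

Lemma metric_nabla_bracket_frame i j k l p : U p ->
  g (nabla p (nabla p (E i p) (E j) - nabla p (E j p) (E i)) (E k)) (E l p) =
  \sum_h (Gamma i j h p - Gamma j i h p) * Gamma h k l p.
Proof.
move=> Up; have sE h := smooth_frame h Up.
rewrite !nabla_frame// -sumrB nabla_suml// metric_suml.
by apply: eq_bigr => h _; rewrite -scalerBl nablaZl// metricZl.
Qed.

Lemma curvature_field_christoffel i j k l p : U p ->
  g (curvature_field nabla (E i) (E j) (E k) p) (E l p) =
  E i p (Gamma j k l) - E j p (Gamma i k l)
  + \sum_h (Gamma j k h p * Gamma i h l p - Gamma i k h p * Gamma j h l p
            - (Gamma i j h p - Gamma j i h p) * Gamma h k l p).
Proof.
move=> Up; have sE h := smooth_frame h Up.
rewrite curvature_fieldE// !metricDl !metricNl metric_nabla_bracket_frame//.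
by rewrite !metric_nabla2_frame// !sumrB; ring.
Qed.

(** The structure functions of the frame. *)
Local Notation C i j k p := (Gamma i j k p - Gamma j i k p).

Lemma lie_bracket_frame i j p : U p ->
  lie_bracket (E i) (E j) p = \sum_k C i j k p *: E k p.
Proof.
move=> Up; have sE h := smooth_frame h Up.
rewrite -tor// !nabla_frame// -sumrB.
by apply: eq_bigr => k _; rewrite scalerBl.
Qed.

Lemma metric_lie_bracket2_frame i j k l p : U p ->
  g (lie_bracket (lie_bracket (E i) (E j)) (E k) p) (E l p) =
  \sum_h C i j h p * C h k l p - E k p (fun q => C i j l q).
Proof.
move=> Up; have sE h := smooth_frame h Up.
have near_bracket : \forall q \near p,
    lie_bracket (E i) (E j) q = \sum_h C i j h q *: E h q.
  by near=> q; apply: lie_bracket_frame; near: q; exact: near_frame.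
have sC h : smooth_at p (fun q => C i j h q).
  by apply: smooth_atB; exact: smooth_at_christoffel.
rewrite -tor//; last exact: (smooth_vfield_at_lie_bracket aff tor).
rewrite (near_eq_nabla aff _ near_bracket) (nbhs_singleton near_bracket).
rewrite (nabla_sum aff _ _ (f := fun h q => C i j h q))// nabla_suml//.
rewrite big_split/= metricDl metricNl !metricDl !metric_suml.
rewrite [X in _ - (X + _)](_ : _ = E k p (fun q => C i j l q)).
  rewrite opprD addrCA addrC -sumrB; congr (_ - _).
  by apply: eq_bigr => h _; rewrite nablaZl// !metricZl -mulrBr.
rewrite (bigD1 l)//= metricZl metric_frame// eqxx mulr1 big1 ?addr0// => h hl.
by rewrite metricZl metric_frame// (negPf hl) mulr0.
Unshelve. all: by end_near. Qed.

(** The component of the Jacobi identity along [E l]. In the trans-Sasakian case it yields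
    [xi_alpha]. *)
Lemma frame_jacobi i j k l p : U p ->
  \sum_h C i j h p * C h k l p - E k p (fun q => C i j l q)
  + (\sum_h C j k h p * C h i l p - E i p (fun q => C j k l q))
  + (\sum_h C k i h p * C h j l p - E j p (fun q => C k i l q)) = 0.
Proof.
move=> Up; have sE h := smooth_frame h Up.
have /(congr1 (fun v => g v (E l p))) :=
  lie_bracket_jacobi aff tor (sE i) (sE j) (sE k).
by rewrite !metricDl !metric_lie_bracket2_frame// metric0l.
Qed.

End OrthonormalFrames.

(** * Trans-Sasakian 3-manifolds *)

Section TransSasakian3.
Context {R : realType} {M : manifold R 3}.
Variables (phi : forall p : M, tangent p -> tangent p) (xi : vfield M)
  (eta : forall p : M, tangent p -> R)
  (g : forall p : M, tangent p -> tangent p -> R)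
  (nabla : connection M) (alpha beta : M -> R) (U : set M) (e1 e2 : vfield M).
Arguments nabla : clear implicits.
Hypotheses (acm : almost_contact_metric phi xi eta g) (lc : levi_civita g nabla).
Hypotheses (ts : trans_sasakian phi xi eta g nabla alpha beta).
Hypotheses (npf : np_frame phi xi g e1 e2 U).
Implicit Types (p : M).

Let rg : riemannian_metric g. Proof. exact: acm_metric acm. Qed.
Let aff : affine_connection nabla. Proof. by case: lc. Qed.
Let oU : open U. Proof. exact: npf_open npf. Qed.

Let E (i : 'I_3) : vfield M := fun p => frame3 xi e1 e2 p i.
(** The indices [i0], [i1], [i2] stand for [e1], [e2], [xi]. *)
Let i0 : 'I_3 := @Ordinal 3 0 isT.
Let i1 : 'I_3 := @Ordinal 3 1 isT.
Let i2 : 'I_3 := @Ordinal 3 2 isT.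

Let Es i : smooth_vfield_on U (E i).
Proof.
case: i => -[|[|[|//]]] ?; [exact: npf_smooth1 npf|exact: npf_smooth2 npf|].
by move=> W f oW WU; apply: (acm_xi_smooth acm).
Qed.

Let Eb p : U p -> is_basis (fun i => E i p).
Proof. exact: (npf_basis npf). Qed.

Let Eo p : U p -> forall i j, g (E i p) (E j p) = (i == j)%:R.
Proof. exact: (npf_orthonormal npf). Qed.

Let sE i p : U p -> smooth_vfield_at p (E i).
Proof. by exists U. Qed.

Lemma sum_ord3 (V : nmodType) (F : 'I_3 -> V) : \sum_i F i = F i0 + F i1 + F i2.
Proof.
rewrite !big_ord_recl big_ord0 addr0 addrA.
by congr (F _ + F _ + F _); exact: val_inj.
Qed.

Let s : R := (Num.sqrt 2)^-1.

Let s_neq0 : s != 0.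
Proof. by rewrite invr_eq0 sqrtr_eq0 -ltNge ltr0n. Qed.

(** Pairs of normalising factors of [np_del] and [np_delbar] meet in this nested form once scalars
    are pulled out of [g]. *)
Let ssE x : s * (s * x) = x / 2.
Proof.
have /(congr1 GRing.inv) : Num.sqrt 2 * Num.sqrt 2 = 2 :> R.
  by rewrite -expr2 sqr_sqrtr.
by rewrite invfM mulrA -/s => ->; rewrite mulrC.
Qed.

Lemma np_delE p : np_del e1 e2 p = (s *: e1 p, - (s *: e2 p)).
Proof.
rewrite /np_del /embedC /=; congr pair => /=.
  by rewrite !(scale0r, scaler0, subr0, addr0, oppr0, add0r, sub0r, scale1r).
by rewrite !(scale0r, scaler0, subr0, addr0, oppr0, add0r, sub0r, scale1r, scalerN).
Qed.

Lemma np_delbarE p : np_delbar e1 e2 p = (s *: e1 p, s *: e2 p).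
Proof.
rewrite /np_delbar /embedC /=; congr pair => /=.
  by rewrite !(scale0r, scaler0, subr0, addr0, oppr0, add0r, sub0r, scale1r).
by rewrite !(scale0r, scaler0, subr0, addr0, oppr0, add0r, sub0r, scale1r, scalerN).
Qed.

Lemma phiZ p a (v : tangent p) : phi (a *: v) = a *: phi v.
Proof.
pose F := HB.pack (@phi p) (GRing.isLinear.Build R _ _ *:%R (@phi p)
  (acm_phi_linear acm (p := p))) : {linear tangent p -> tangent p}.
by rewrite -[@phi p]/(F : _ -> _) linearZ.
Qed.

(** Imaginary and real parts of the eigenvalue equation for [np_del], divided by [s]. *)
Lemma phi_frame p : U p -> phi (e1 p) = e2 p /\ phi (e2 p) = - e1 p.
Proof.
move=> Up; have := npf_del npf Up; rewrite np_delE /linC => -[].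
rewrite /= !scale0r !scale1r sub0r add0r opprK -scalerN !phiZ => h1 h2.
split; first exact: (scalerI s_neq0).
apply: oppr_inj; apply: (scalerI s_neq0); rewrite opprK -h2.
by rewrite -[- e2 p]scaleN1r phiZ scaleN1r.
Qed.

(** This is [acm_compat] at [w = xi], where [phi xi = 0] and [eta xi = 1]. *)
Lemma metric_xi p (v : tangent p) : g v (xi p) = eta v.
Proof.
have := acm_compat acm v (xi p).
rewrite (acm_phi_xi acm) (acm_eta_xi acm) mulr1 (metricC rg) (metric0l rg).
by move=> /esym/eqP; rewrite subr_eq0 => /eqP.
Qed.

(** * Connection coefficients of the frame [e1], [e2], [xi] *)

Local Notation Gamma := (christoffel g nabla E).

Lemma eta_frame p : U p -> (eta (e1 p) = 0) * (eta (e2 p) = 0).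
Proof.
move=> Up; rewrite -!metric_xi; have := Eo Up i0 i2; have := Eo Up i1 i2.
by rewrite /E /frame3/= => -> ->.
Qed.

(** For [Y = xi] the term [nabla (phi Y)] vanishes and the trans-Sasakian equation gives
    [phi (nabla_v xi)]. Since [phi] preserves inner products with vectors in the kernel of [eta],
    pairing with [phi e1 = e2] and [phi e2 = - e1] recovers the components. *)
Lemma nabla_xi_frame p (v : tangent p) : U p ->
  (g (nabla p v xi) (e1 p) = alpha p * g v (e2 p) + beta p * g (phi v) (e2 p)) *
  (g (nabla p v xi) (e2 p) = - (alpha p * g v (e1 p) + beta p * g (phi v) (e1 p))).
Proof.
move=> Up; have [phi1 phi2] := phi_frame Up.
have sxi : smooth_vfield_at p xi by exact: (sE i2 Up).
have [x1 x2] : g (xi p) (e1 p) = 0 /\ g (xi p) (e2 p) = 0.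
  have := Eo Up i2 i0; have := Eo Up i2 i1.
  by rewrite /E /frame3/= => -> ->.
have := ts_eq ts v sxi.
(* Written as a constant multiple of [xi], the zero field falls under [nabla_cstZ]. *)
rewrite (_ : (fun q => phi (xi q)) = fun q => 0 *: xi q); last first.
  by apply: vfield_ext => q; rewrite (acm_phi_xi acm) scale0r.
rewrite nabla_cstZ// scale0r sub0r (acm_eta_xi acm) !scale1r metric_xi.
rewrite metric_xi (acm_eta_phi acm) scale0r sub0r => /eqP.
rewrite eqr_oppLR => /eqP phiW.
have compat w : eta w = 0 -> g (nabla p v xi) w = g (phi (nabla p v xi)) (phi w).
  by move=> w0; rewrite (acm_compat acm) w0 mulr0 subr0.
rewrite !compat ?eta_frame// phi1 phi2 phiW.
rewrite !(metricNr rg, metricNl rg, metricDl rg, metricZl rg) x1 x2.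
by split; ring.
Qed.

Lemma christoffel_xi p : U p ->
  ((Gamma i0 i2 i0 p = beta p) * (Gamma i1 i2 i0 p = alpha p) *
   (Gamma i2 i2 i0 p = 0)) *
  ((Gamma i0 i2 i1 p = - alpha p) * (Gamma i1 i2 i1 p = beta p) *
   (Gamma i2 i2 i1 p = 0)).
Proof.
move=> Up; have [phi1 phi2] := phi_frame Up.
have o i j : g (E i p) (E j p) = (i == j)%:R by exact: Eo.
have := (o i0 i0, o i0 i1, o i1 i0, o i1 i1, o i2 i0, o i2 i1).
rewrite /E /frame3/= => oE.
rewrite /christoffel /E /frame3/= !nabla_xi_frame//.
rewrite phi1 phi2 (acm_phi_xi acm) !(metricNl rg, metric0l rg).
by rewrite !oE; do !split; ring.
Qed.

(** Used as a rewriting rule, this leaves only [Gamma i i0 i1] of the 27 coefficients: antisymmetry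
    removes the diagonal and one of each pair, and those involving [xi] are known. *)
Lemma christoffelE p : U p ->
  ((Gamma i0 i0 i0 p = 0) * (Gamma i0 i1 i1 p = 0) * (Gamma i0 i2 i2 p = 0) *
   (Gamma i1 i0 i0 p = 0) * (Gamma i1 i1 i1 p = 0) * (Gamma i1 i2 i2 p = 0) *
   (Gamma i2 i0 i0 p = 0) * (Gamma i2 i1 i1 p = 0) * (Gamma i2 i2 i2 p = 0)) *
  ((Gamma i0 i2 i0 p = beta p) * (Gamma i0 i0 i2 p = - beta p) *
   (Gamma i1 i2 i0 p = alpha p) * (Gamma i1 i0 i2 p = - alpha p) *
   (Gamma i2 i2 i0 p = 0) * (Gamma i2 i0 i2 p = 0)) *
  ((Gamma i0 i2 i1 p = - alpha p) * (Gamma i0 i1 i2 p = alpha p) *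
   (Gamma i1 i2 i1 p = beta p) * (Gamma i1 i1 i2 p = - beta p) *
   (Gamma i2 i2 i1 p = 0) * (Gamma i2 i1 i2 p = 0)) *
  ((Gamma i0 i1 i0 p = - Gamma i0 i0 i1 p) *
   (Gamma i1 i1 i0 p = - Gamma i1 i0 i1 p) *
   (Gamma i2 i1 i0 p = - Gamma i2 i0 i1 p)).
Proof.
move=> Up; have anti := christoffel_antisym rg lc oU Es Eo.
have Gjj i j : Gamma i j j p = 0.
  by have := anti i j j p Up; lra.
have xE := christoffel_xi Up.
rewrite !Gjj -!(anti _ i1 i0 p Up).
rewrite (anti i0 i0 i2)// (anti i1 i0 i2)// (anti i2 i0 i2)//.
rewrite (anti i0 i1 i2)// (anti i1 i1 i2)// (anti i2 i1 i2)//.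
by rewrite !xE oppr0 opprK.
Qed.

Lemma smooth_at_Gamma i j k p : U p -> smooth_at p (Gamma i j k).
Proof. exact: smooth_at_christoffel. Qed.

Lemma eq_tangent_on p : U p -> forall (v : tangent p) f h,
  (forall q, U q -> f q = h q) -> v f = v h.
Proof.
move=> Up v f h fh; apply: near_eq_tangent.
by near=> q; apply: fh; near: q; exact: near_frame.
Unshelve. all: by end_near. Qed.

Lemma smooth_at_setT p f : smooth_on [set: M] f -> smooth_at p f.
Proof. by exists setT; split=> //; exact: openT. Qed.

(** The identities of [christoffelE] hold on the open set [U], hence can be differentiated at its
    points. *)
Lemma tangent_christoffelE p (v : tangent p) : U p ->
  ((v (Gamma i0 i0 i0) = 0) * (v (Gamma i0 i1 i1) = 0) * (v (Gamma i0 i2 i2) = 0) *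
   (v (Gamma i1 i0 i0) = 0) * (v (Gamma i1 i1 i1) = 0) * (v (Gamma i1 i2 i2) = 0) *
   (v (Gamma i2 i0 i0) = 0) * (v (Gamma i2 i1 i1) = 0) * (v (Gamma i2 i2 i2) = 0)) *
  ((v (Gamma i0 i2 i0) = v beta) * (v (Gamma i0 i0 i2) = - v beta) *
   (v (Gamma i1 i2 i0) = v alpha) * (v (Gamma i1 i0 i2) = - v alpha) *
   (v (Gamma i2 i2 i0) = 0) * (v (Gamma i2 i0 i2) = 0)) *
  ((v (Gamma i0 i2 i1) = - v alpha) * (v (Gamma i0 i1 i2) = v alpha) *
   (v (Gamma i1 i2 i1) = v beta) * (v (Gamma i1 i1 i2) = - v beta) *
   (v (Gamma i2 i2 i1) = 0) * (v (Gamma i2 i1 i2) = 0)) *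
  ((v (Gamma i0 i1 i0) = - v (Gamma i0 i0 i1)) *
   (v (Gamma i1 i1 i0) = - v (Gamma i1 i0 i1)) *
   (v (Gamma i2 i1 i0) = - v (Gamma i2 i0 i1))).
Proof.
move=> Up.
have sa : smooth_at p alpha by apply: smooth_at_setT; exact: ts_alpha_smooth ts.
have sb : smooth_at p beta by apply: smooth_at_setT; exact: ts_beta_smooth ts.
have sG i j k := smooth_at_Gamma i j k Up.
have C f : (forall q, U q -> f q = 0) -> v f = 0.
  by move=> f0; rewrite (eq_tangent_on Up v f0) tangent_cst.
have N f h : smooth_at p h -> (forall q, U q -> f q = - h q) -> v f = - v h.
  by move=> sh fh; rewrite (eq_tangent_on Up v fh) tangentN.
do !split; first [by apply: C => q Uq; rewrite christoffelE
  | by apply: N => // q Uq; rewrite christoffelE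
  | by apply: eq_tangent_on => // q Uq; rewrite christoffelE].
Qed.

(* The [xi]-component of the Jacobi identity; equivalently [d (d eta) = 0]. *)
Lemma xi_alpha p : U p -> xi p alpha = - (2 * alpha p * beta p) :> R.
Proof.
move=> Up; have := frame_jacobi rg lc oU Es Eb Eo i0 i1 i2 i2 Up.
rewrite !sum_ord3 !(tangentB _ (smooth_at_Gamma _ _ _ Up) (smooth_at_Gamma _ _ _ Up)).
rewrite !tangent_christoffelE// !christoffelE//.
rewrite -[E i2 p alpha]/(xi p alpha : R).
by move=> h; apply/eqP; rewrite -subr_eq0; apply/eqP; nra.
Qed.

(** The traced curvature differentiates only coefficients with a repeated index; [alpha] and
    [Gamma i2 i0 i1] have three distinct indices, so no derivative of them appears. *)
Lemma scalar_curvature_christoffel p : U p -> scalar_curvature nabla g p =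
  - (2 * xi p beta) - 3 * beta p ^+ 2 + alpha p ^+ 2
  - Gamma i0 i0 i1 p ^+ 2 - Gamma i1 i0 i1 p ^+ 2
  + 2 * alpha p * Gamma i2 i0 i1 p
  + e2 p (Gamma i0 i0 i1) - e1 p (Gamma i1 i0 i1).
Proof.
move=> Up; rewrite (scalar_curvature_frame rg lc oU Es Eb Eo)//.
rewrite !sum_ord3 !(curvature_field_christoffel rg lc oU Es Eb Eo)//.
rewrite !sum_ord3 !tangent_christoffelE// !christoffelE//.
rewrite -[E i2 p]/(xi p) -[E i1 p]/(e2 p) -[E i0 p]/(e1 p).
by field.
Qed.

(** * Spin coefficients and their derivatives in real terms *)

Lemma rho_npE p : U p -> rho_np xi g nabla e1 e2 p = beta p +i* alpha p.
Proof.
move=> Up; rewrite /rho_np /bilC /nablaC np_delE np_delbarE /np_xi /embedC/=.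
have sxi : smooth_vfield_at p xi by exact: (sE i2 Up).
(* The imaginary part of [np_xi] is the zero field. *)
have n0 v : nabla p v (fun q => 0) = 0.
  by rewrite -[RHS](scale0r (nabla p v xi)) -nabla_cstZ//; congr nabla;
    apply: vfield_ext => q; rewrite scale0r.
rewrite !n0 subr0 add0r !nablaZl//.
rewrite !(metricNl rg, metricNr rg, metricZl rg, metricZr rg) !(metricC rg (e1 p)).
rewrite !(metricC rg (e2 p)).
have := christoffel_xi Up; rewrite /christoffel /E /frame3/= => xE.
(* The real part is half the sum of the diagonal components of [nabla xi] on [e1], [e2]; the
   imaginary part is half the difference of the off-diagonal ones. *)
by rewrite !xE !ssE; congr (_ +i* _); field.
Qed.

Lemma beta_npE p : U p ->
  beta_np g nabla e1 e2 p = (s * Gamma i1 i0 i1 p) +i* (s * Gamma i0 i0 i1 p).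
Proof.
move=> Up; rewrite /beta_np /bilC /nablaC np_delbarE np_delE/=.
have s1 : smooth_vfield_at p e1 by exact: (sE i0 Up).
have s2 : smooth_vfield_at p e2 by exact: (sE i1 Up).
(* Both parts of [np_del] are constant multiples of frame fields, so no derivative of a coefficient
   arises. *)
rewrite (_ : (fun q => (np_del e1 e2 q).1) = fun q => s *: e1 q); last first.
  by apply: vfield_ext => q; rewrite np_delE.
rewrite (_ : (fun q => (np_del e1 e2 q).2) = fun q => (- s) *: e2 q); last first.
  by apply: vfield_ext => q; rewrite np_delE/= scaleNr.
rewrite !(nabla_cstZ aff)// !(nablaNl aff, nablaZl aff)//.
rewrite !(metricNl rg, metricNr rg, metricDr rg, metricZl rg, metricZr rg).
rewrite !(metricC rg (e1 p)) !(metricC rg (e2 p)).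
have := christoffelE Up; rewrite /christoffel /E /frame3/= => H; rewrite !H.
by rewrite !(mulrN, mulNr) !ssE; congr (_ +i* _); field.
Qed.

Lemma epsilon_npE p : U p ->
  epsilon_np xi g nabla e1 e2 p = 0 +i* Gamma i2 i0 i1 p.
Proof.
move=> Up; rewrite /epsilon_np /bilC /nablaC np_delbarE /np_xi /embedC/=.
have s1 : smooth_vfield_at p e1 by exact: (sE i0 Up).
have s2 : smooth_vfield_at p e2 by exact: (sE i1 Up).
rewrite (_ : (fun q => (np_del e1 e2 q).1) = fun q => s *: e1 q); last first.
  by apply: vfield_ext => q; rewrite np_delE.
rewrite (_ : (fun q => (np_del e1 e2 q).2) = fun q => (- s) *: e2 q); last first.
  by apply: vfield_ext => q; rewrite np_delE/= scaleNr.
rewrite !(nabla_cstZ aff)// !(nabla0l aff)// !scaler0 subr0 addr0.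
rewrite !(metricNl rg, metricNr rg, metricDr rg, metricZl rg, metricZr rg).
rewrite !(metricC rg (e1 p)) !(metricC rg (e2 p)).
have := christoffelE Up; rewrite /christoffel /E /frame3/= => H; rewrite !H.
by rewrite !(mulrN, mulNr) !ssE; congr (_ +i* _); field.
Qed.

Lemma norm_beta_np p : U p -> `|beta_np g nabla e1 e2 p| ^+ 2 =
  ((Gamma i0 i0 i1 p ^+ 2 + Gamma i1 i0 i1 p ^+ 2) / 2)%:C.
Proof.
move=> Up; rewrite -add_Re2_Im2 beta_npE//=; congr (_%:C).
by rewrite !exprMn !expr2 -!mulrA !ssE; field.
Qed.

Lemma direct_derivCE p (v w : tangent p) f :
  direct_derivC ((v, w) : complexified (tangent p)) f =
  ((v (@complex.Re R \o f) : R) - (w (@complex.Im R \o f) : R)) +i*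
  ((v (@complex.Im R \o f) : R) + (w (@complex.Re R \o f) : R)).
Proof. by []. Qed.

Lemma xi_rho_np p : U p ->
  direct_derivC (np_xi xi p) (rho_np xi g nabla e1 e2) = xi p beta +i* xi p alpha.
Proof.
move=> Up; rewrite /np_xi /embedC direct_derivCE !tangent0E subr0 addr0.
by congr (_ +i* _); apply: (eq_tangent_on Up) => q Uq; rewrite [LHS]/comp rho_npE.
Qed.

Lemma delbar_beta_np p : U p ->
  direct_derivC (np_delbar e1 e2 p) (beta_np g nabla e1 e2) =
  ((e1 p (Gamma i1 i0 i1) - e2 p (Gamma i0 i0 i1)) / 2) +i*
  ((e1 p (Gamma i0 i0 i1) + e2 p (Gamma i1 i0 i1)) / 2).
Proof.
move=> Up; rewrite np_delbarE direct_derivCE.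
have Dbeta (v : tangent p) : v (@complex.Re R \o beta_np g nabla e1 e2) =
      s * v (Gamma i1 i0 i1) :> R /\
    v (@complex.Im R \o beta_np g nabla e1 e2) =
      s * v (Gamma i0 i0 i1) :> R.
  rewrite -!(tangentZ v s (smooth_at_Gamma _ _ _ Up)).
  by split; apply: (eq_tangent_on Up) => q Uq; rewrite [LHS]/comp beta_npE.
have [Dre1 Dim1] := Dbeta (e1 p); have [Dre2 Dim2] := Dbeta (e2 p).
rewrite !tangentZE Dre1 Dim1 Dre2 Dim2 !ssE.
by congr (_ +i* _); field.
Qed.

(** [np_del] is the conjugate of [np_delbar]. Hence the last two terms of the formula for the scalar
    curvature add up to a real number. *)
Lemma del_conj_beta_np p : U p ->
  direct_derivC (np_del e1 e2 p) (fun q => conjc (beta_np g nabla e1 e2 q)) =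
  conjc (direct_derivC (np_delbar e1 e2 p) (beta_np g nabla e1 e2)).
Proof.
move=> Up; rewrite np_delbarE np_delE !direct_derivCE.
have sRe : smooth_at p (@complex.Re R \o beta_np g nabla e1 e2).
  have /smooth_atM := smooth_at_cst p s; move=> /(_ _ (smooth_at_Gamma i1 i0 i1 Up)).
  apply: eq_smooth_at; near=> q; rewrite [RHS]/comp beta_npE//; near: q;
    exact: near_frame.
have sIm : smooth_at p (@complex.Im R \o beta_np g nabla e1 e2).
  have /smooth_atM := smooth_at_cst p s; move=> /(_ _ (smooth_at_Gamma i0 i0 i1 Up)).
  apply: eq_smooth_at; near=> q; rewrite [RHS]/comp beta_npE//; near: q;
    exact: near_frame.
have -> : @complex.Re R \o (fun q => conjc (beta_np g nabla e1 e2 q)) =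
    @complex.Re R \o beta_np g nabla e1 e2.
  by apply/funext => q; rewrite /comp; case: beta_np.
have -> : @complex.Im R \o (fun q => conjc (beta_np g nabla e1 e2 q)) =
    fun q => - (@complex.Im R \o beta_np g nabla e1 e2) q.
  by apply/funext => q; rewrite /comp; case: beta_np.
rewrite !(tangentNE, tangentZE) !tangentN//.
by congr (_ +i* _); ring.
Unshelve. all: by end_near. Qed.

End TransSasakian3.

Unset Implicit Arguments.

Theorem proposition4p13 (R : realType) (M : manifold R 3)
    (phi : forall p : M, tangent p -> tangent p) (xi : vfield M)
    (eta : forall p : M, tangent p -> R)
    (g : forall p : M, tangent p -> tangent p -> R)
    (nabla : connection M) (alpha beta : M -> R)
    (U : set M) (e1 e2 : vfield M) :
  almost_contact_metric phi xi eta g ->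
  levi_civita g nabla ->
  trans_sasakian phi xi eta g nabla alpha beta ->
  np_frame phi xi g e1 e2 U ->
  let del := np_del e1 e2 in
  let delbar := np_delbar e1 e2 in
  let rho := rho_np xi g nabla e1 e2 in
  let beta_ := beta_np g nabla e1 e2 in
  let epsilon := epsilon_np xi g nabla e1 e2 in
  forall p : M, U p ->
    (scalar_curvature nabla g p)%:C =
      - (2 * direct_derivC (np_xi xi p) rho) - 2 * rho p ^+ 2
      - `|rho p| ^+ 2 - 2 * `|beta_ p| ^+ 2
      - (rho p - conjc (rho p)) * epsilon p
      - direct_derivC (del p) (fun q => conjc (beta_ q))
      - direct_derivC (delbar p) beta_.
Proof.
move=> acm lc ts npf del delbar rho beta_ epsilon p Up.
rewrite /del /delbar /rho /beta_ /epsilon.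
rewrite (del_conj_beta_np acm lc ts npf Up) (delbar_beta_np acm lc ts npf Up).
rewrite (xi_rho_np acm lc ts npf Up) (norm_beta_np acm lc ts npf Up).
(* Both [rho - conjc rho] and [epsilon] are purely imaginary, so their product enters the real part
   only. *)
rewrite -add_Re2_Im2 (rho_npE acm lc ts npf Up) (epsilon_npE acm lc ts npf Up).
rewrite (scalar_curvature_christoffel acm lc ts npf Up).
(* The numeral 2 is exposed as an embedded real, so that real and imaginary parts can be
   computed. *)
rewrite (xi_alpha acm lc ts npf Up) -[2 : R[i]](rmorph_nat (real_complex R)).
rewrite !expr2; apply/eqP; rewrite eq_complex; apply/andP.
by split; apply/eqP => /=; field.
Qed.
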